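(* Let $\rho:\mathbb{C}\to\mathbb{C}$ be an analytic function that is real on $\mathbb{R}$, let $\varepsilon\in\mathbb{R}\setminus\{0\}$, and suppose that $I_\rho=\{u\in\mathbb{R}:\rho(u)>0\}$ is connected and nonempty. Then there exists a (unique up to phase) unitary representation of $\mathcal{A}(\rho,\varepsilon)$ on a vector space $V$ with (orthonormal) basis $\{|m\rangle\}_{m\in M}$, where $M\subset\mathbb{Z}$ (when $I_\rho$ is bounded, $\varepsilon$ is subject to the constraint stated in the first case below). This is given by $$X_0|m\rangle=\varepsilon(m+\lambda)|m\rangle,\qquad X_+|m\rangle=\overline{D(m+1)}\,|m+1\rangle,\qquad X_-|m\rangle=D(m)\,|m-1\rangle,$$ where $\lambda\in\mathbb{R}$, $0\le\lambda<1$, and $|D(m)|^2=\rho(\varepsilon m+\varepsilon\lambda)$. Exactly one of the following three occurs: - If $|I_\rho|$ is finite, then $M$ is a finite range of $\mathbb{Z}$ and $\varepsilon$ is constrained by $|I_\rho|/\varepsilon=\dim V\in\mathbb{Z}$. - If $I_\rho$ is bounded from one side (only), then so is $M$, and $\dim V=\infty$. - If $I_\rho=\mathbb{R}$, then $M=\mathbb{Z}$ and $\dim V=\infty$.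
   Context: For an analytic function $\rho:\mathbb{C}\to\mathbb{C}$ and a constant $\varepsilon$, $\mathcal{A}(\rho,\varepsilon)$ is the complex algebra of (noncommutative) polynomials generated by $\{X_0,X_+,X_-\}\cup\{\rho(X_0+r\varepsilon): r\in\mathbb{Z}\}$, quotiented by the ideal generated by $$[X_0,X_+]=\varepsilon X_+,\quad [X_0,X_-]=-\varepsilon X_-,\quad X_+X_-=\rho(X_0),\quad X_-X_+=\rho(X_0+\varepsilon).$$ Here functions of $X_0$ commute with one another, and, as the first two relations express, $h(X_0)X_\pm=X_\pm h(X_0\pm\varepsilon)$ for such functions $h$. For $\rho$ real on $\mathbb{R}$ and $\varepsilon$ real, the conjugation on $\mathcal{A}(\rho,\varepsilon)$ is the conjugate-linear anti-automorphism with $X_0^\dagger=X_0$, $X_+^\dagger=X_-$, $X_-^\dagger=X_+$. A representation is unitary if $\dagger$ is represented by the adjoint, i.e. $\langle v,X_0w\rangle=\langle X_0v,w\rangle$ and $\langle v,X_+w\rangle=\langle X_-v,w\rangle$ for $v,w$ in the span of the basis vectors. $|I_\rho|$ denotes the difference between the two endpoints of $I_\rho$ if $I_\rho$ is bounded, and $\infty$ otherwise. A range of $\mathbb{Z}$ is a set of consecutive integers. If $M$ has a smallest element $m_{\min}$ then $D(m_{\min})=0$, and if it has a largest element $m_{\max}$ then $D(m_{\max}+1)=0$, so that the formulas do not leave $V$ (terms involving $|m\rangle$ with $m\notin M$ are zero). ''Up to phase'' refers to the phases of the complex numbers $D(m)$, whose moduli are fixed by $\rho$.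
   Formalization: Uniqueness of M, λ and the three cases are for representations with X_0|m⟩=ε(m+λ)|m⟩ and spectra of X_0, X_0+ε in the closure of I_ρ (else false: ρ=u(1-u)(u-2)², ε=1); λ is free if I_ρ=ℝ; |ε| replaces ε in |I_ρ|/ε. *)

(* Defs.v *)
From HB Require Import structures.
From mathcomp Require Import all_boot all_order all_algebra sesquilinear.
From mathcomp Require Import complex.
From mathcomp Require Import all_classical all_reals all_analysis.

Set Implicit Arguments.
Unset Strict Implicit.
Unset Printing Implicit Defensive.

Import Order.TTheory GRing.Theory Num.Theory.
Import numFieldNormedType.Exports.

Local Open Scope classical_set_scope.
Local Open Scope ring_scope.

(* R[i] seen through its numClosedFieldType structure: this is what gives
   access to the norm topology of MathComp-Analysis. *)
Definition Cx (R : realType) : numClosedFieldType := R[i].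

Definition toC (R : realType) (u : R) : Cx R := (u%:C)%C.

Definition analytic (R : realType) (f : Cx R -> Cx R) : Prop :=
  forall z0 : Cx R, exists (a : nat -> Cx R) (r : Cx R), 0 < r /\
    forall z : Cx R, `|z - z0| < r ->
      series (fun n => a n * (z - z0) ^+ n) @ \oo --> f z.

Definition I_set (R : realType) (rho : Cx R -> Cx R) : set R :=
  [set u | 0 < rho (toC u)].

Definition set_length (R : realType) (A : set R) : \bar R :=
  if `[< has_lbound A /\ has_ubound A >] then (sup A - inf A)%:E else +oo%E.

Definition one_sided (d : Order.disp_t) (T : porderType d) (A : set T) : Prop :=
  (has_lbound A /\ ~ has_ubound A) \/ (~ has_lbound A /\ has_ubound A).

Definition is_range (M : set int) : Prop :=
  forall a b c : int, M a -> M b -> a <= c -> c <= b -> M c.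

Definition exactly_one (P Q S : Prop) : Prop :=
  [\/ [/\ P, ~ Q & ~ S], [/\ ~ P, Q & ~ S] | [/\ ~ P, ~ Q & S]].

(* The algebra A(rho, eps) is [ncpoly] modulo [eqA].
   [gRho r] is the generator rho (X_0 + r eps); the constant polynomials are
   [nc_const c], so that scaling by c is multiplication by [nc_const c]. *)

Inductive gen : Type := gX0 | gXp | gXm | gRho of int.

Inductive ncpoly (R : realType) : Type :=
| nc_const of Cx R
| nc_gen of gen
| nc_add of ncpoly R & ncpoly R
| nc_mul of ncpoly R & ncpoly R.

Arguments nc_gen {R}.

Inductive eqA (R : realType) (eps : R) : ncpoly R -> ncpoly R -> Prop :=
| eqA_refl a : eqA eps a a
| eqA_sym a b : eqA eps a b -> eqA eps b a
| eqA_trans a b c : eqA eps a b -> eqA eps b c -> eqA eps a c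
| eqA_add a a' b b' :
    eqA eps a a' -> eqA eps b b' -> eqA eps (nc_add a b) (nc_add a' b')
| eqA_mul a a' b b' :
    eqA eps a a' -> eqA eps b b' -> eqA eps (nc_mul a b) (nc_mul a' b')
(* unital associative C-algebra *)
| eqA_addA a b c : eqA eps (nc_add a (nc_add b c)) (nc_add (nc_add a b) c)
| eqA_addC a b : eqA eps (nc_add a b) (nc_add b a)
| eqA_add0 a : eqA eps (nc_add (nc_const 0) a) a
| eqA_addN a :
    eqA eps (nc_add a (nc_mul (nc_const (-1)) a)) (nc_const 0)
| eqA_mulA a b c : eqA eps (nc_mul a (nc_mul b c)) (nc_mul (nc_mul a b) c)
| eqA_mul1 a : eqA eps (nc_mul (nc_const 1) a) a
| eqA_mulDl a b c :
    eqA eps (nc_mul (nc_add a b) c) (nc_add (nc_mul a c) (nc_mul b c))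
| eqA_mulDr a b c :
    eqA eps (nc_mul a (nc_add b c)) (nc_add (nc_mul a b) (nc_mul a c))
| eqA_constD c d :
    eqA eps (nc_add (nc_const c) (nc_const d)) (nc_const (c + d))
| eqA_constM c d :
    eqA eps (nc_mul (nc_const c) (nc_const d)) (nc_const (c * d))
| eqA_constC c a : eqA eps (nc_mul (nc_const c) a) (nc_mul a (nc_const c))
(* functions of X_0 commute with one another *)
| eqA_X0Rho r :
    eqA eps (nc_mul (nc_gen gX0) (nc_gen (gRho r)))
            (nc_mul (nc_gen (gRho r)) (nc_gen gX0))
| eqA_RhoRho r s :
    eqA eps (nc_mul (nc_gen (gRho r)) (nc_gen (gRho s)))
            (nc_mul (nc_gen (gRho s)) (nc_gen (gRho r)))
(* [X_0, X_+] = eps X_+ and [X_0, X_-] = - eps X_- *)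
| eqA_X0Xp :
    eqA eps
      (nc_add (nc_mul (nc_gen gX0) (nc_gen gXp))
         (nc_mul (nc_const (-1)) (nc_mul (nc_gen gXp) (nc_gen gX0))))
      (nc_mul (nc_const (toC eps)) (nc_gen gXp))
| eqA_X0Xm :
    eqA eps
      (nc_add (nc_mul (nc_gen gX0) (nc_gen gXm))
         (nc_mul (nc_const (-1)) (nc_mul (nc_gen gXm) (nc_gen gX0))))
      (nc_mul (nc_const (- toC eps)) (nc_gen gXm))
(* h(X_0) X_+- = X_+- h(X_0 +- eps) for h = rho (. + r eps) *)
| eqA_RhoXp r :
    eqA eps (nc_mul (nc_gen (gRho r)) (nc_gen gXp))
            (nc_mul (nc_gen gXp) (nc_gen (gRho (r + 1))))
| eqA_RhoXm r :
    eqA eps (nc_mul (nc_gen (gRho r)) (nc_gen gXm))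
            (nc_mul (nc_gen gXm) (nc_gen (gRho (r - 1))))
(* X_+ X_- = rho (X_0) and X_- X_+ = rho (X_0 + eps) *)
| eqA_XpXm : eqA eps (nc_mul (nc_gen gXp) (nc_gen gXm)) (nc_gen (gRho 0))
| eqA_XmXp : eqA eps (nc_mul (nc_gen gXm) (nc_gen gXp)) (nc_gen (gRho 1)).

Definition dagger_gen (g : gen) : gen :=
  match g with gXp => gXm | gXm => gXp | _ => g end.

Fixpoint dagger (R : realType) (a : ncpoly R) : ncpoly R :=
  match a with
  | nc_const c => nc_const (Num.conj c)
  | nc_gen g => nc_gen (dagger_gen g)
  | nc_add a b => nc_add (dagger a) (dagger b)
  | nc_mul a b => nc_mul (dagger b) (dagger a)
  end.

Fixpoint nc_eval (R : realType) (V : lmodType (Cx R))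
    (op : gen -> {linear V -> V}) (a : ncpoly R) (v : V) : V :=
  match a with
  | nc_const c => c *: v
  | nc_gen g => op g v
  | nc_add a b => nc_eval op a v + nc_eval op b v
  | nc_mul a b => nc_eval op a (nc_eval op b v)
  end.

(* Linear operators for the generators, compatible with equality in
   A(rho, eps).  The generators rho (X_0 + r eps) are formal symbols of the
   algebra; the second clause says that they act as these functions of X_0. *)
Definition is_rep (R : realType) (rho : Cx R -> Cx R) (eps : R)
    (V : lmodType (Cx R)) (op : gen -> {linear V -> V}) : Prop :=
  (forall a b : ncpoly R, eqA eps a b -> nc_eval op a =1 nc_eval op b) /\
  (forall (r : int) (x : Cx R) (v : V), op gX0 v = x *: v ->
     op (gRho r) v = rho (x + toC (r%:~R * eps)) *: v).

Definition is_unitary (R : realType) (V : lmodType (Cx R))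
    (ip : {dot V for Num.conj}) (op : gen -> {linear V -> V}) : Prop :=
  forall (a : ncpoly R) (v w : V),
    ip v (nc_eval op a w) = ip (nc_eval op (dagger a) v) w.

(* (e i), i in A, is an algebraic basis of V. *)
Definition is_basis (K : fieldType) (V : lmodType K) (T : choiceType)
    (A : set T) (e : T -> V) : Prop :=
  (forall (s : seq T) (c : T -> K), uniq s -> (forall i, i \in s -> A i) ->
     \sum_(i <- s) c i *: e i = 0 -> forall i, i \in s -> c i = 0) /\
  (forall v : V, exists (s : seq T) (c : T -> K),
     (forall i, i \in s -> A i) /\ v = \sum_(i <- s) c i *: e i).

Definition has_dim (K : fieldType) (V : lmodType K) (n : nat) : Prop :=
  exists e : nat -> V, is_basis `I_n e.

Definition infinite_dim (K : fieldType) (V : lmodType K) : Prop :=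
  forall n : nat, ~ has_dim V n.

(* A unitary representation on V with orthonormal basis |m>, m in M, such that
   X_0 |m> = eps (m + lambda) |m>.  By convention |m> = 0 for m outside M. *)
Record unitary_rep (R : realType) (rho : Cx R -> Cx R) (eps : R) : Type :=
  UnitaryRep {
    rep_space : lmodType (Cx R);
    rep_ip : {dot rep_space for Num.conj};
    rep_op : gen -> {linear rep_space -> rep_space};
    rep_labels : set int;
    rep_lam : R;
    rep_ket : int -> rep_space;
    _ : is_rep rho eps rep_op;
    _ : is_unitary rep_ip rep_op;
    _ : rep_labels !=set0;
    _ : 0 <= rep_lam < 1;
    _ : is_basis rep_labels rep_ket;
    _ : forall m n : int, rep_labels m -> rep_labels n ->
          rep_ip (rep_ket m) (rep_ket n) = (m == n)%:R;
    _ : forall m : int, ~ rep_labels m -> rep_ket m = 0;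
    _ : forall m : int, rep_labels m ->
          rep_op gX0 (rep_ket m) = toC (eps * (m%:~R + rep_lam)) *: rep_ket m
  }.

(* The m at which D (m) occurs in the formulas: m in M (from X_-) and
   m - 1 in M (from X_+). *)
Definition D_dom (M : set int) : set int := [set m | M m \/ M (m - 1)].

Definition ladder_form (R : realType) (rho : Cx R -> Cx R) (eps : R)
    (T : unitary_rep rho eps) (D : int -> Cx R) : Prop :=
  [/\ forall m : int, rep_labels T m ->
        rep_op T gXp (rep_ket T m) = Num.conj (D (m + 1)) *: rep_ket T (m + 1),
      forall m : int, rep_labels T m ->
        rep_op T gXm (rep_ket T m) = D m *: rep_ket T (m - 1),
      forall m : int, D_dom (rep_labels T) m ->
        `|D m| ^+ 2 = rho (toC (eps * m%:~R + eps * rep_lam T)),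
      forall m : int, rep_labels T m ->
        (forall k, rep_labels T k -> m <= k) -> D m = 0
    & forall m : int, rep_labels T m ->
        (forall k, rep_labels T k -> k <= m) -> D (m + 1) = 0].

(* The spectra of X_0 and X_0 + eps lie in the closure of I_rho.  This rules
   out the representations whose ends sit at zeros of rho away from I_rho:
   for rho (u) = u (1 - u) (u - 2) ^ 2 and eps = 1, I_rho = ]0, 1[, but
   X_0 = 1, X_+ = X_- = 0 is also a one-dimensional unitary representation. *)
Definition supported (R : realType) (rho : Cx R -> Cx R) (eps : R)
    (T : unitary_rep rho eps) : Prop :=
  forall m : int, D_dom (rep_labels T) m ->
    closure (I_set rho) (eps * (m%:~R + rep_lam T)).

(* Main.v *)
Require Import Defs.
From HB Require Import structures.
From mathcomp Require Import all_boot all_order all_algebra sesquilinear.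
From mathcomp Require Import complex.
From mathcomp Require Import all_classical all_reals all_analysis.
From mathcomp Require Import ring lra zify.

Set Implicit Arguments.
Unset Strict Implicit.
Unset Printing Implicit Defensive.

Import Order.TTheory GRing.Theory Num.Theory.
Import numFieldNormedType.Exports.

Local Open Scope classical_set_scope.
Local Open Scope ring_scope.

(* Rescale by [eps]: [J = {x | rho (eps x) > 0}] is an open interval, at whose
   endpoints [rho (eps x)] vanishes.  A vector [X_+ |m>] is an eigenvector of
   [X_0] for the next eigenvalue, and its squared norm is
   [rho (eps (m + 1 + lambda))].  Hence the ladder [m + lambda], m in M, can be
   continued upwards or downwards as long as it stays in [J], and stops only at
   an endpoint: every endpoint of [J] lies on [Z + lambda], and M is the set of
   all m for which [m + lambda] and [m + 1 + lambda] are in the closure of [J].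
   Conversely, if [Z + lambda] contains the endpoints, then weighted shifts on
   the finitely supported functions on this M give a representation. *)

(** * Continuity of rho on the real line *)

(** Working with [J] treats both signs of [eps] at once, since [X_+] always raises [m] by one. The
    difficulty is that the ends of a ladder are not given: they are places where [rho] vanishes, and
    continuity of [rho] on the line ties them to the endpoints of [J]. A label needs both
    [m + lambda] and [m + 1 + lambda] in the closure because [X_- |m>] and [X_+ |m>] have as squared
    norms the values of [rho] at these two rescaled points. One endpoint fixes [lambda] modulo 1. A
    second one forces the length of [J] to be an integer, which is the constraint on [eps]. Without
    endpoints [lambda] stays free. *)

(* On the circle [`|z - z0| = s] the terms are bounded, so that the tail of the
   series is dominated by a geometric series of ratio [`|z - z0| / s]. *)
Lemma power_series_continuous_at (K : numFieldType) (f : K -> K) (a : nat -> K)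
    (z0 r e : K) : 0 < r ->
  (forall z, `|z - z0| < r -> series (fun n => a n * (z - z0) ^+ n) @ \oo --> f z) ->
  0 < e ->
  exists2 d : K, 0 < d & forall z, `|z - z0| < d -> `|f z - f z0| < e.
Proof.
move=> r0 fE e0.
pose s := r / 2.
have s0 : 0 < s by rewrite divr_gt0.
have sr : s < r by rewrite ltr_pdivrMr// ltr_pMr// ltr1n.
have fz0 : f z0 = a 0%N.
  have := fE z0; rewrite subrr normr0 => /(_ r0) h1.
  apply: (cvg_unique _ h1) => //; apply: cvg_near_cst; exists 1%N => // -[//|n] _.
  rewrite /series /= big_nat_recl//= expr0 mulr1 big1 ?addr0// => i _.
  by rewrite expr0n mulr0.
(* The series converges at [z0 + s], so its terms [a n * s ^+ n] tend to 0 and are bounded. *)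
have [B B0 aB] : exists2 B : K, 0 < B & forall n, `|a n| * s ^+ n <= B.
  have := fE (z0 + s); rewrite addrC addKr gtr0_norm// => /(_ sr) h.
  have h0 : (fun n => a n * s ^+ n) @ \oo --> 0.
    by apply: cvg_series_cvg_0; apply/cvg_ex; eexists; exact: h.
  have /cvg_seq_bounded/pinfty_ex_gt0[M M0 hM] : cvgn (fun n => a n * s ^+ n).
    by apply/cvg_ex; exists 0.
  exists M => // n; have := hM n Logic.I => /=.
  by rewrite normrM normrX (gtr0_norm s0).
(* The factor [1 - 2^-1 ^+ N] makes the induction close: as [t] is at most 1/2, the next term is at
   most [B * t * 2^-1 ^+ N]. *)
have part z : `|z - z0| <= s / 2 -> forall N,
    `|series (fun n => a n * (z - z0) ^+ n) N.+1 - a 0%N| <=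
      2 * B * (`|z - z0| / s) * (1 - 2^-1 ^+ N).
  move=> zs; have [t tE] : exists t, t = `|z - z0| / s by eexists.
  rewrite -tE.
  have t0 : 0 <= t by rewrite tE divr_ge0// ltW.
  have t2 : t <= 2^-1 by rewrite tE ler_pdivrMr// mulrC.
  elim => [|N IH].
    by rewrite /series /= big_nat1 expr0 mulr1 subrr normr0 expr0 subrr mulr0.
  rewrite /series /= big_nat_recr//= -/(series _ _) addrAC.
  apply: (le_trans (ler_normD _ _)).
  have step : `|a N.+1 * (z - z0) ^+ N.+1| <= B * t * 2^-1 ^+ N.
    rewrite normrM normrX.
    have -> : `|z - z0| = s * t by rewrite tE mulrC divfK// gt_eqF.
    rewrite exprMn [t ^+ _]exprS !mulrA.
    apply: ler_pM.
    - by apply: mulr_ge0 => //; apply: mulr_ge0 => //; apply: exprn_ge0; exact: ltW.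
    - by rewrite exprn_ge0.
    - by apply: ler_wpM2r => //; exact: aB.
    - by apply: lerXn2r; rewrite ?nnegrE// invr_ge0 ler0n.
  apply: (le_trans (lerD IH step)).
  suff -> : 2 * B * t * (1 - 2^-1 ^+ N) + B * t * 2^-1 ^+ N =
            2 * B * t * (1 - 2^-1 ^+ N.+1) by [].
  by rewrite exprS; field.
(* Chosen so that [2 * B * (d / s)] equals [e / 2]. *)
pose d := e * s / (4 * B).
have d0 : 0 < d by rewrite divr_gt0 ?mulr_gt0.
have real0 (x : K) : 0 < x -> x \is Num.real by move=> x0; rewrite realE ltW.
have s20 : 0 < s / 2 by rewrite divr_gt0.
(* The order of [K] is only partial, so the minimum below needs comparable arguments. *)
have cmp : s / 2 >=< d by apply: real_comparable; apply: real0.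
exists (Num.min (s / 2) d) => [|z]; first by rewrite comparable_lt_min// s20.
rewrite comparable_lt_min//.
move=> /andP[zs zd].
have zr : `|z - z0| < r.
  by apply: (lt_trans zs); apply: lt_trans sr; rewrite ltr_pdivrMr// ltr_pMr// ltr1n.
have /cvgrPdist_lt /(_ (e / 2)) := fE z zr.
rewrite divr_gt0// => /(_ erefl)[N _ /(_ N.+1 (leqnSn N))] /= h.
rewrite fz0 -(subrK (series (fun n => a n * (z - z0) ^+ n) N.+1) (f z)) -addrA.
apply: (le_lt_trans (ler_normD _ _)).
rewrite [ltRHS]splitr; apply: (ltr_leD h).
apply: (le_trans (part z (ltW zs) N)).
have B20 : 0 <= 2 * B by apply: mulr_ge0 => //; exact: ltW.
have t0 : 0 <= 2 * B * (`|z - z0| / s) by rewrite mulr_ge0// divr_ge0// ltW.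
apply: (@le_trans _ _ (2 * B * (`|z - z0| / s))).
  by rewrite ler_piMr// gerBl exprn_ge0// invr_ge0 ler0n.
apply: (@le_trans _ _ (2 * B * (d / s))).
  by rewrite ler_wpM2l// ler_pM2r ?invr_gt0// ltW.
suff -> : 2 * B * (d / s) = e / 2 by [].
by rewrite /d; field; rewrite !gt_eqF.
Qed.

Lemma norm_toCB (R : realType) (u v : R) : `|toC u - toC v| = toC `|u - v|.
Proof.
by rewrite -(rmorphB (real_complex R)) normc_def /= expr0n addr0 sqrtr_sqr.
Qed.

Lemma toCM (R : realType) (u v : R) : toC (u * v) = toC u * toC v.
Proof. exact: (rmorphM (real_complex R)). Qed.

Lemma toCD (R : realType) (u v : R) : toC (u + v) = toC u + toC v.
Proof. exact: (rmorphD (real_complex R)). Qed.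

Lemma conj_toC (R : realType) (u : R) : Num.conj (toC u) = toC u.
Proof. by apply: conj_Creal; rewrite realE !lecR; exact: le_total. Qed.

(** * Sign and zeros of rho on the real line *)

Section real_restriction.
Context (R : realType) (rho : Cx R -> Cx R).
Hypothesis rho_real : forall u : R, rho (toC u) \is Num.real.

Definition rhoR (u : R) : R := complex.Re (rho (toC u)).

Lemma toC_rhoR u : rho (toC u) = toC (rhoR u).
Proof. by rewrite /toC RRe_real. Qed.

Lemma I_setE : I_set rho = [set u | 0 < rhoR u].
Proof. by apply/seteqP; split=> u /=; rewrite /I_set /= toC_rhoR ltcR. Qed.

Lemma rhoR_continuous : analytic rho -> continuous rhoR.
Proof.
move=> rho_analytic u; apply/cvgrPdist_lt => e e0.
have e0' : 0 < toC e by rewrite ltcR.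
have [a [r [r0 fE]]] := rho_analytic (toC u).
have [d d0 h] := power_series_continuous_at r0 fE e0'.
have dE : toC (complex.Re d) = d by rewrite /toC RRe_real// realE ltW.
have d0' : 0 < complex.Re d by have := d0; rewrite -{1}dE ltcR.
apply/nbhs_ballP; exists (complex.Re d) => // v uv.
have /h : `|toC v - toC u| < d by rewrite -dE norm_toCB distrC ltcR.
by rewrite !toC_rhoR norm_toCB distrC ltcR.
Qed.

Lemma I_set_open : analytic rho -> open (I_set rho).
Proof.
move=> rho_analytic; rewrite I_setE.
apply: (@open_comp _ _ rhoR [set x | 0 < x]) => [u _|]; last exact: open_gt.
exact: rhoR_continuous.
Qed.

(** Continuity makes [rho] nonnegative on the closure, and off [I_set rho] it is nonpositive. *)
Lemma rhoR_boundary u : analytic rho ->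
  closure (I_set rho) u -> ~ I_set rho u -> rhoR u = 0.
Proof.
move=> rho_analytic cu nu; apply/eqP; rewrite eq_le; apply/andP; split.
  by rewrite leNgt; apply/negP => u0; apply: nu; rewrite I_setE.
have c : closed [set v | 0 <= rhoR v].
  apply: (@closed_comp _ _ rhoR [set x | 0 <= x]) => [v _|]; last exact: closed_ge.
  exact: rhoR_continuous.
apply: c; apply: closure_subset cu => v /=.
by rewrite I_setE => /ltW.
Qed.

End real_restriction.

(** * Open intervals and their endpoints *)

Definition boundary_pt (R : realType) (J : set R) (e : R) : Prop :=
  closure J e /\ ~ J e.

Section open_interval.
Context {R : realType}.
Implicit Types (J : set R) (c e u v x y z : R).

(** One inclusion is continuity of the scaling; the other is the same inclusion for the inverse
    factor. *)
Lemma closure_preimage_scale J c : c != 0 ->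
  closure [set x | J (c * x)] = [set x | closure J (c * x)].
Proof.
move=> c0.
have sub (A : set R) (d : R) : closure [set x | A (d * x)] `<=` [set x | closure A (d * x)].
  move=> x cx.
  have cl : closed [set x | closure A (d * x)].
    apply: (@closed_comp _ _ ( *%R d) (closure A)) => [y _|]; last exact: closed_closure.
    exact: mulrl_continuous.
  by apply: cl; apply: closure_subset cx => y /=; exact: (@subset_closure _ A).
apply/seteqP; split; first exact: sub.
move=> x /= cx.
have -> : x = c^-1 * (c * x) by rewrite mulKf.
apply: (sub [set x | J (c * x)] c^-1) => /=.
by apply: closure_subset cx => y /=; rewrite mulVKf.
Qed.

Lemma open_preimage_scale J c : open J -> open [set x | J (c * x)].
Proof.
move=> oJ; apply: (@open_comp _ _ ( *%R c) J) => // y _.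
exact: mulrl_continuous.
Qed.

Lemma is_interval_preimage_scale J c :
  is_interval J -> is_interval [set x | J (c * x)].
Proof.
move=> iJ x y /= Jx Jy z /andP[xz zy].
have [c0|c0] := leP 0 c.
  by apply: iJ Jx Jy _ _; rewrite !ler_wpM2l.
by apply: iJ Jy Jx _ _; rewrite !ler_wnM2l// ltW.
Qed.

(** The inequalities are strict, so each closure point can be replaced by a point of [J] on the same
    side of [z]. *)
Lemma interval_closure_between J x y z : is_interval J ->
  closure J x -> closure J y -> x < z < y -> J z.
Proof.
move=> iJ cx cy /andP[xz zy].
have [x' [Jx' x'z]] := cx _ (lt_nbhsl xz).
have [y' [Jy' zy']] := cy _ (lt_nbhsr zy).
apply: (iJ _ _ Jx' Jy'); apply/andP; split; exact: ltW.
Qed.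

Lemma boundary_pt_sup J : open J -> J !=set0 -> has_ubound J ->
  boundary_pt J (sup J).
Proof.
move=> oJ J0 ub; split; first exact: closure_sup.
move=> Js; have /nbhs_ballP[d /= d0 sub] := oJ _ Js.
have : J (sup J + d / 2).
  by apply: sub; rewrite /ball /= opprD addNKr normrN gtr0_norm ?divr_gt0//; lra.
by move=> /(ub_le_sup ub); lra.
Qed.

Lemma boundary_pt_preimage_scale J c e : c != 0 ->
  boundary_pt [set x | J (c * x)] e <-> boundary_pt J (c * e).
Proof. by move=> c0; rewrite /boundary_pt closure_preimage_scale. Qed.

(** Reflection is treated as scaling by -1, so that left endpoints are reduced to right
    endpoints. *)
Lemma preimage_oppE J : [set x | J (-1 * x)] = -%R @` J.
Proof.
apply/seteqP; split => [x /= Jx|_ /= [x Jx <-]]; last by rewrite mulN1r opprK.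
by exists (- x); rewrite ?opprK// -mulN1r.
Qed.

Lemma boundary_pt_inf J : open J -> J !=set0 -> has_lbound J ->
  boundary_pt J (inf J).
Proof.
move=> oJ [x Jx] lb; rewrite /inf -mulN1r.
apply/boundary_pt_preimage_scale; first by rewrite oppr_eq0 oner_eq0.
rewrite -preimage_oppE; apply: boundary_pt_sup.
- exact: open_preimage_scale.
- by exists (- x); rewrite /= mulN1r opprK.
- by rewrite preimage_oppE; exact/has_lb_ubN.
Qed.

(** The interval cannot pass [v] without containing it, so [sup J] exists and is the endpoint
    sought. *)
Lemma boundary_pt_right J u v : open J -> is_interval J ->
  J u -> u < v -> ~ closure J v -> exists2 e, u < e < v & boundary_pt J e.
Proof.
move=> oJ iJ Ju uv nv.
have ubv : ubound J v.
  move=> w Jw; rewrite leNgt; apply/negP => vw; apply: nv.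
  by apply: subset_closure; apply: (iJ _ _ Ju Jw); rewrite !ltW.
have ub : has_ubound J by exists v.
have bs := boundary_pt_sup oJ (ex_intro _ _ Ju) ub.
exists (sup J) => //; rewrite !lt_neqAle; apply/andP; split; apply/andP; split.
- by apply/eqP => uE; apply: bs.2; rewrite -uE.
- exact: ub_le_sup.
- by apply/eqP => vE; apply: nv; rewrite -vE; exact: bs.1.
- by apply: ge_sup => //; exists u.
Qed.

Lemma boundary_pt_left J u v : open J -> is_interval J ->
  J u -> v < u -> ~ closure J v -> exists2 e, v < e < u & boundary_pt J e.
Proof.
move=> oJ iJ Ju vu nv; have n0 : (-1 : R) != 0 by rewrite oppr_eq0 oner_eq0.
have [|||||e uev be] := @boundary_pt_right [set x | J (-1 * x)] (- u) (- v).
- exact: open_preimage_scale.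
- exact: is_interval_preimage_scale.
- by rewrite /= mulN1r opprK.
- by rewrite ltrN2.
- by rewrite closure_preimage_scale//= mulN1r opprK.
exists (-1 * e); last exact/boundary_pt_preimage_scale.
by rewrite mulN1r; lra.
Qed.

Lemma boundary_pt_exists J : open J -> is_interval J -> J !=set0 ->
  J <> setT -> exists e, boundary_pt J e.
Proof.
move=> oJ iJ [u Ju] JT.
have [v nv] : exists v, ~ J v.
  apply/existsNP => h; apply: JT; apply/seteqP; split => // x _; exact: h.
have [cv|ncv] := pselect (closure J v); first by exists v.
have [uv|vu|uv] := ltgtP u v; last by rewrite -uv in nv.
  by have [e _ be] := boundary_pt_right oJ iJ Ju uv ncv; exists e.
by have [e _ be] := boundary_pt_left oJ iJ Ju vu ncv; exists e.
Qed.

Lemma closure_segmentE J p q : is_interval J ->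
  boundary_pt J p -> boundary_pt J q -> p < q -> closure J = [set x | p <= x <= q].
Proof.
move=> iJ [cp np] [cq nq] pq; apply/seteqP; split => [x cx /=|x /= /andP[]].
  apply/andP; split; rewrite leNgt; apply/negP => h.
    by apply: np; apply: (interval_closure_between iJ cx cq); rewrite h.
  by apply: nq; apply: (interval_closure_between iJ cp cx); rewrite pq.
rewrite le_eqVlt => /predU1P[<- //|px].
rewrite le_eqVlt => /predU1P[-> //|xq].
by apply: subset_closure; apply: (interval_closure_between iJ cp cq); rewrite px.
Qed.

Lemma closure_right_rayE J p : is_interval J ->
  boundary_pt J p -> ~ has_ubound J -> closure J = [set x | p <= x].
Proof.
move=> iJ [cp np] nub.
have above x : exists2 y, J y & x < y.
  apply: contrapT => h; apply: nub; exists x => y Jy; rewrite leNgt.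
  by apply/negP => xy; apply: h; exists y.
apply/seteqP; split => [x cx /=|x /=].
  rewrite leNgt; apply/negP => xp; have [y Jy py] := above p; apply: np.
  by apply: (interval_closure_between iJ cx (subset_closure Jy)); rewrite xp.
rewrite le_eqVlt => /predU1P[<- //|px]; have [y Jy xy] := above x.
apply: subset_closure.
by apply: (interval_closure_between iJ cp (subset_closure Jy)); rewrite px.
Qed.

Lemma closure_left_rayE J p : is_interval J ->
  boundary_pt J p -> ~ has_lbound J -> closure J = [set x | x <= p].
Proof.
move=> iJ [cp np] nlb.
have below x : exists2 y, J y & y < x.
  apply: contrapT => h; apply: nlb; exists x => y Jy; rewrite leNgt.
  by apply/negP => yx; apply: h; exists y.
apply/seteqP; split => [x cx /=|x /=].
  rewrite leNgt; apply/negP => px; have [y Jy yp] := below p; apply: np.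
  by apply: (interval_closure_between iJ (subset_closure Jy) cx); rewrite yp.
rewrite le_eqVlt => /predU1P[-> //|xp]; have [y Jy yx] := below x.
apply: subset_closure.
by apply: (interval_closure_between iJ (subset_closure Jy) cp); rewrite yx.
Qed.

Lemma closure_le_sup J x : has_ubound J -> closure J x -> x <= sup J.
Proof.
move=> ub cx; have : closure [set y | y <= sup J] x.
  by apply: closure_subset cx => y Jy; exact: ub_le_sup.
exact: closed_le.
Qed.

Lemma closure_ge_inf J x : has_lbound J -> closure J x -> inf J <= x.
Proof.
move=> lb cx; have : closure [set y | inf J <= y] x.
  by apply: closure_subset cx => y Jy; exact: inf_lbound.
exact: closed_ge.
Qed.

Lemma set_length_lty J : (set_length J < +oo)%E <-> has_lbound J /\ has_ubound J.
Proof.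
rewrite /set_length; case: asboolP => [lub|nlub]; first by rewrite ltry.
by rewrite ltxx.
Qed.

Lemma set_length_segment J p q : is_interval J -> J !=set0 ->
  boundary_pt J p -> boundary_pt J q -> p < q -> set_length J = (q - p)%:E.
Proof.
move=> iJ J0 bp bq pq; have cE := closure_segmentE iJ bp bq pq.
have sub x : J x -> p <= x <= q by move=> /subset_closure; rewrite cE.
have lb : has_lbound J by exists p => x /sub /andP[].
have ub : has_ubound J by exists q => x /sub /andP[].
rewrite /set_length asboolT//; congr (_ - _)%:E; apply/eqP; rewrite eq_le.
  by rewrite (closure_le_sup ub bq.1) andbT; apply: ge_sup => // x /sub /andP[].
by rewrite (closure_ge_inf lb bp.1) /=; apply: lb_le_inf => // x /sub /andP[].
Qed.

Lemma has_ubound_preimage_scale J c : 0 < c ->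
  has_ubound [set x | J (c * x)] <-> has_ubound J.
Proof.
move=> c0; split => -[b hb].
  exists (c * b) => x Jx; rewrite -ler_pdivrMl//; apply: hb.
  by rewrite /= mulVKf// gt_eqF.
by exists (c^-1 * b) => x /hb; rewrite ler_pdivlMl.
Qed.

Lemma has_lbound_preimage_scale J c : 0 < c ->
  has_lbound [set x | J (c * x)] <-> has_lbound J.
Proof.
move=> c0; split => -[b hb].
  exists (c * b) => x Jx; rewrite -ler_pdivlMl//; apply: hb.
  by rewrite /= mulVKf// gt_eqF.
by exists (c^-1 * b) => x /hb; rewrite ler_pdivrMl.
Qed.

Lemma one_sided_preimage_scale J c : c != 0 ->
  one_sided J -> one_sided [set x | J (c * x)].
Proof.
have pos (A : set R) (d : R) : 0 < d -> one_sided A ->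
    one_sided [set x | A (d * x)].
  move=> d0; rewrite /one_sided.
  by rewrite (propext (has_ubound_preimage_scale A d0)) (propext (has_lbound_preimage_scale A d0)).
rewrite neq_lt => /orP[c0|]; last exact: pos.
have nc0 : 0 < - c by rewrite oppr_gt0.
(* For negative [c], reflect first and then scale by [- c]; the reflection exchanges the two
   alternatives of [one_sided]. *)
have -> : [set x | J (c * x)] = [set x | [set y | J (-1 * y)] (- c * x)].
  by apply/seteqP; split => x /=; rewrite mulN1r -mulNr opprK.
move=> h; apply: pos => //; move: h.
rewrite /one_sided preimage_oppE -(propext (has_lb_ubN J)) -(propext (has_ub_lbN J)).
by case=> -[? ?]; [right|left].
Qed.

End open_interval.

(** * Labels of a ladder *)

Section ladder_labels.
Context {R : realType} (J : set R) (l : R).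
Hypotheses (oJ : open J) (iJ : is_interval J).
Implicit Types (M : set int) (m k : int) (e : R).

Local Notation pt m := (m%:~R + l).

Lemma pt_succ m : pt (m + 1) = pt m + 1 :> R.
Proof. by rewrite intrD addrAC. Qed.

Lemma pt_pred m : pt (m - 1) = pt m - 1 :> R.
Proof. by rewrite intrB addrAC. Qed.

(** * What a given ladder forces on its labels and on the endpoints *)

Section ladder.
Context (M : set int).
Hypothesis M_closure : forall m, D_dom M m -> closure J (pt m).
Hypothesis M_pred : forall m, M m -> J (pt m) -> M (m - 1).
Hypothesis M_succ : forall m, M m -> J (pt (m + 1)) -> M (m + 1).
Hypothesis M0 : M !=set0.

Lemma ladder_closure m : M m -> closure J (pt m).
Proof. by move=> Mm; apply: M_closure; left. Qed.

Lemma ladder_closure_succ m : M m -> closure J (pt (m + 1)).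
Proof. by move=> Mm; apply: M_closure; right; rewrite addrK. Qed.

(** Each [m] on the right is reached from [m0] by unit steps: the point that decides whether a step
    is allowed lies strictly between two points of the closure, hence in [J]. The condition at
    [m + 1] supplies the upper point on the way up, the one at [m] the lower point on the way
    down. *)
Lemma ladder_labelsE : M = [set m | closure J (pt m) /\ closure J (pt (m + 1))].
Proof.
have [m0 Mm0] := M0.
apply/seteqP; split => [m Mm|m /= [cm cm1]].
  by split; [exact: ladder_closure|exact: ladder_closure_succ].
have [mm0|mm0] := leP m0 m.
  suff up (n : nat) : m0 + n%:Z <= m -> M (m0 + n%:Z).
    have -> : m = m0 + `|m - m0|%N%:Z by lia.
    by apply: up; lia.
  elim: n => [_|n IH le]; first by rewrite addr0.
  have Mn : M (m0 + n%:Z) by apply: IH; lia.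
  have -> : m0 + n.+1%:Z = m0 + n%:Z + 1 by lia.
  apply: M_succ => //.
  apply: (interval_closure_between iJ (ladder_closure Mn) cm1).
  by apply/andP; split; rewrite ltrD2r ltr_int; lia.
suff down (n : nat) : m <= m0 - n%:Z -> M (m0 - n%:Z).
  have -> : m = m0 - `|m - m0|%N%:Z by lia.
  by apply: down; lia.
elim: n => [_|n IH le]; first by rewrite subr0.
have Mn : M (m0 - n%:Z) by apply: IH; lia.
have -> : m0 - n.+1%:Z = m0 - n%:Z - 1 by lia.
apply: M_pred => //.
apply: (interval_closure_between iJ cm (ladder_closure_succ Mn)).
by apply/andP; split; rewrite ltrD2r ltr_int; lia.
Qed.

(* Otherwise the ladder could be climbed for ever towards [e] without
   reaching it. *)
Lemma ladder_boundary_pt e : boundary_pt J e -> exists k, e = pt k.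
Proof.
move=> [ce nJe]; apply: contrapT => /forallNP ne; have [m0 Mm0] := M0.
(* An endpoint strictly between two closure points would belong to [J]. So a unit step of the ladder
   cannot jump over [e], and by assumption it cannot land on [e] either. *)
have out x y : closure J x -> closure J y -> ~ (x < e < y).
  by move=> cx cy /(interval_closure_between iJ cx cy).
have neq k : e != pt k by apply/eqP; exact: ne.
have [lt0|ge0] := ltP e (pt m0).
  suff down (n : nat) : M (m0 - n%:Z) /\ e < pt (m0 - n%:Z).
    (* Archimedean contradiction: after that many unit steps the ladder would have passed [e]. *)
    have [_] := down (Num.truncn (pt m0 - e)).+1.
    rewrite intrB.
    have := truncnS_gt (pt m0 - e).
    by rewrite -pmulrn; lra.
  elim: n => [|n [Mn ltn]]; first by rewrite subr0.
  have -> : m0 - n.+1%:Z = m0 - n%:Z - 1 by lia.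
  have Mn1 : M (m0 - n%:Z - 1).
    apply: M_pred => //.
    apply: (interval_closure_between iJ ce (ladder_closure_succ Mn)).
    by rewrite ltn pt_succ ltrDl ltr01.
  split => //; rewrite ltNge le_eqVlt eq_sym (negbTE (neq _)) /=.
  by apply/negP => h; apply: (out _ _ (ladder_closure Mn1) (ladder_closure Mn)); rewrite h ltn.
suff up (n : nat) : M (m0 + n%:Z) /\ pt (m0 + n%:Z) < e.
  have [_] := up (Num.truncn (e - pt m0)).+1.
  rewrite intrD.
  have := truncnS_gt (e - pt m0).
  by rewrite -pmulrn; lra.
have le_lt m : pt m <= e -> pt m < e.
  by rewrite le_eqVlt eq_sym (negbTE (neq _)).
elim: n => [|n [Mn ltn]]; first by rewrite addr0; split => //; exact: le_lt.
have -> : m0 + n.+1%:Z = m0 + n%:Z + 1 by lia.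
have lt1 : pt (m0 + n%:Z + 1) < e.
  apply: le_lt; rewrite leNgt; apply/negP => h.
  by apply: (out _ _ (ladder_closure Mn) (ladder_closure_succ Mn)); rewrite ltn h.
split => //; apply: M_succ => //.
apply: (interval_closure_between iJ (ladder_closure Mn) ce).
by rewrite lt1 pt_succ ltrDl ltr01.
Qed.

End ladder.

(** * Labels of the ladder to be built, when the endpoints lie on the lattice *)

Section saturated.
Hypothesis J0 : J !=set0.
Hypothesis J_lattice : forall e, boundary_pt J e -> exists k, e = pt k.

Definition closure_labels : set int :=
  [set m | closure J (pt m) /\ closure J (pt (m + 1))].

Let lattice_gap m k : ~ (pt m < pt k < pt (m + 1)).
Proof. by rewrite !ltrD2r !ltr_int; lia. Qed.

(** The label [m - 1] can fail only because its point leaves the closure. If [J] contained the point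
    of [m], an endpoint would then lie strictly between two consecutive lattice points. This gives
    the zero of [rho] at the lower end of the ladder. *)
Lemma closure_labels_pred m :
  closure_labels m -> ~ closure_labels (m - 1) -> ~ J (pt m).
Proof.
move=> [cm _] n1 Jm; apply: n1; split; last by rewrite subrK.
apply: contrapT => nc.
have lt : pt (m - 1) < pt m by rewrite pt_pred; lra.
have [e h /J_lattice[k eE]] := boundary_pt_left oJ iJ Jm lt nc.
by apply: (@lattice_gap (m - 1) k); rewrite subrK -eE.
Qed.

Lemma closure_labels_succ m :
  closure_labels m -> ~ closure_labels (m + 1) -> ~ J (pt (m + 1)).
Proof.
move=> [_ cm] n1 Jm; apply: n1; split; first by [].
apply: contrapT => nc.
have lt : pt (m + 1) < pt (m + 1 + 1) by rewrite (pt_succ (m + 1)); lra.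
have [e h /J_lattice[k eE]] := boundary_pt_right oJ iJ Jm lt nc.
by apply: (@lattice_gap (m + 1) k); rewrite -eE.
Qed.

(** The lattice cell around a point [u] of [J] has no endpoint in its interior, so both its ends are
    in the closure. *)
Lemma closure_labels_neq0 : closure_labels !=set0.
Proof.
have [u Ju] := J0; pose m := Num.floor (u - l).
have lem : pt m <= u by rewrite -lerBrDr; exact: floor_le.
have ltm : u < pt (m + 1) by rewrite -ltrBlDr; exact: floorD1_gt.
exists m; split; apply: contrapT => nc.
  move: lem; rewrite le_eqVlt => /predU1P[uE|lem].
    by apply: nc; rewrite uE; exact: subset_closure.
  have [e /andP[h1 h2] /J_lattice[k eE]] := boundary_pt_left oJ iJ Ju lem nc.
  by apply: (@lattice_gap m k); rewrite -eE h1 (lt_trans h2).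
have [e /andP[h1 h2] /J_lattice[k eE]] := boundary_pt_right oJ iJ Ju ltm nc.
by apply: (@lattice_gap m k); rewrite -eE h2 (le_lt_trans lem).
Qed.

End saturated.

End ladder_labels.

Lemma int_add_frac_inj (R : realType) (k k' : int) (l l' : R) :
  0 <= l < 1 -> 0 <= l' < 1 -> k%:~R + l = k'%:~R + l' -> l = l'.
Proof.
move=> hl hl' E; suff kk : k = k' by move: E; rewrite kk => /addrI.
have h1 : (k%:~R : R) < (k' + 1)%:~R by rewrite intrD; lra.
have h2 : (k'%:~R : R) < (k + 1)%:~R by rewrite intrD; lra.
by move: h1 h2; rewrite !ltr_int; lia.
Qed.

(** * Bases *)

Section bases.
Context {K : fieldType} {V : lmodType K}.

Lemma is_basis_reindex (T T' : choiceType) (A : set T) (B : set T')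
    (e : T -> V) (h : T' -> T) (g : T -> T') :
  (forall x, B x -> A (h x)) -> (forall x, B x -> g (h x) = x) ->
  (forall y, A y -> B (g y)) -> (forall y, A y -> h (g y) = y) ->
  is_basis A e -> is_basis B (e \o h).
Proof.
move=> hBA ghK gAB hgK [free span]; split => [s c us sB s0 i si|v].
  rewrite -[c i]/(c i) -(ghK i (sB i si)).
  apply: (free (map h s) (c \o g)).
  - rewrite map_inj_in_uniq// => x y xs ys hxy.
    by rewrite -(ghK x (sB x xs)) hxy ghK//; exact: sB.
  - by move=> _ /mapP[x xs ->]; exact/hBA/sB.
  - rewrite big_map -[RHS]s0; apply: eq_big_seq => x xs /=.
    by rewrite ghK//; exact: sB.
  - exact: map_f.
have [s [c [sA ->]]] := span v.
exists (map g s), (c \o h); split => [_ /mapP[y ys ->]|]; first exact/gAB/sA.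
by rewrite big_map; apply: eq_big_seq => y ys /=; rewrite hgK//; exact: sA.
Qed.

(** The lists allowed by the spanning clause of [is_basis] may repeat an index; [d] accumulates the
    repeated coefficients. *)
Lemma sum_ord_of_seq (n : nat) (f : nat -> V) (s : seq nat) (c : nat -> K) :
  (forall i, i \in s -> (i < n)%N) ->
  exists d : nat -> K, \sum_(i <- s) c i *: f i = \sum_(i < n) d i *: f i.
Proof.
elim: s => [_|i s IH sn].
  by exists (fun=> 0); rewrite big_nil big1// => i _; rewrite scale0r.
have [|d dE] := IH; first by move=> j js; apply: sn; rewrite inE js orbT.
have ltin : (i < n)%N by apply: sn; rewrite mem_head.
exists (fun j => (if j == i then c i else 0) + d j).
rewrite big_cons dE.
under [RHS]eq_bigr do rewrite scalerDl.
rewrite big_split /=; congr (_ + _).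
rewrite (bigD1 (Ordinal ltin))//= eqxx big1 ?addr0// => j /negbTE jE.
by rewrite -val_eqE /= in jE; rewrite jE scale0r.
Qed.

(** If [n] vectors spanned, the coefficient matrix of [n.+1] basis vectors would have more rows than
    columns; a nonzero row in its left kernel is a linear relation between these basis vectors. *)
Lemma infinite_dim_basis (T : choiceType) (A : set T) (e : T -> V) :
  is_basis A e ->
  (forall n, exists s : seq T, [/\ uniq s, size s = n & forall x, x \in s -> A x]) ->
  infinite_dim V.
Proof.
move=> [free _] big n [f [_ span]].
have [s [us ss sA]] := big n.+1.
have x0 : T by case: s ss {us sA} => // x.
have coef x : exists d : nat -> K, e x = \sum_(i < n) d i *: f i.
  have [r [c [rn ->]]] := span (e x); exact: sum_ord_of_seq.
have /choice[d dE] := coef.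
pose C : 'M[K]_(n.+1, n) := \matrix_(j, i) d (nth x0 s j) i.
have : kermx C != 0.
  by rewrite -mxrank_eq0 mxrank_ker subn_eq0 -ltnNge ltnS rank_leq_col.
case/rowV0Pn => w /sub_kermxP wC /negP; apply.
have w0 : \sum_(x <- s) w 0 (inord (index x s)) *: e x = 0.
  rewrite (big_nth x0) big_mkord ss.
  under eq_bigr => j _.
    rewrite index_uniq ?ss// inord_val dE scaler_sumr.
    under eq_bigr do rewrite scalerA.
    over.
  rewrite exchange_big /= big1// => i _; rewrite -scaler_suml.
  have <- : (w *m C) 0 i = \sum_(j < n.+1) w 0 j * d (nth x0 s j) i.
    by rewrite mxE; apply: eq_bigr => j _; rewrite mxE.
  by rewrite wC mxE scale0r.
apply/eqP/rowP => j; rewrite mxE.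
have := free s (fun x => w 0 (inord (index x s))) us sA w0 (nth x0 s j).
by rewrite index_uniq ?ss// inord_val; apply; rewrite mem_nth ?ss.
Qed.

End bases.

(** * Unitary representations *)

Section unitary_rep_theory.
Context {R : realType} {rho : Cx R -> Cx R} {eps : R}.
Implicit Types T : unitary_rep rho eps.

Lemma unitary_rep_rep T : is_rep rho eps (rep_op T).
Proof. by case: T. Qed.

Lemma unitary_rep_unitary T : Defs.is_unitary (rep_ip T) (rep_op T).
Proof. by case: T. Qed.

Lemma unitary_rep_labels_neq0 T : rep_labels T !=set0.
Proof. by case: T. Qed.

Lemma unitary_rep_lam T : 0 <= rep_lam T < 1.
Proof. by case: T. Qed.

Lemma unitary_rep_basis T : is_basis (rep_labels T) (rep_ket T).
Proof. by case: T. Qed.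

Lemma unitary_rep_orthonormal T m n : rep_labels T m -> rep_labels T n ->
  rep_ip T (rep_ket T m) (rep_ket T n) = (m == n)%:R.
Proof. by case: T m n. Qed.

Lemma unitary_rep_ket0 T m : ~ rep_labels T m -> rep_ket T m = 0.
Proof. by case: T m. Qed.

Lemma unitary_rep_X0_ket T m :
  rep_op T gX0 (rep_ket T m) = toC (eps * (m%:~R + rep_lam T)) *: rep_ket T m.
Proof.
have [Mm|/unitary_rep_ket0 ->] := pselect (rep_labels T m).
  by case: T m Mm.
by rewrite linear0 scaler0.
Qed.

Lemma unitary_rep_adjoint_p T v w :
  rep_ip T v (rep_op T gXp w) = rep_ip T (rep_op T gXm v) w.
Proof. exact: (unitary_rep_unitary (nc_gen gXp) v w). Qed.

Lemma unitary_rep_adjoint_m T v w :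
  rep_ip T v (rep_op T gXm w) = rep_ip T (rep_op T gXp v) w.
Proof. exact: (unitary_rep_unitary (nc_gen gXm) v w). Qed.

Lemma unitary_rep_adjoint_0 T v w :
  rep_ip T v (rep_op T gX0 w) = rep_ip T (rep_op T gX0 v) w.
Proof. exact: (unitary_rep_unitary (nc_gen gX0) v w). Qed.

Lemma unitary_rep_X0Xp T v : rep_op T gX0 (rep_op T gXp v) =
  rep_op T gXp (rep_op T gX0 v) + toC eps *: rep_op T gXp v.
Proof.
have [+ _] := unitary_rep_rep T => /(_ _ _ (eqA_X0Xp eps) v) /= <-.
by rewrite scaleN1r addrC subrK.
Qed.

Lemma unitary_rep_X0Xm T v : rep_op T gX0 (rep_op T gXm v) =
  rep_op T gXm (rep_op T gX0 v) - toC eps *: rep_op T gXm v.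
Proof.
have [+ _] := unitary_rep_rep T => /(_ _ _ (eqA_X0Xm eps) v) /=.
by rewrite scaleN1r scaleNr => <-; rewrite addrC subrK.
Qed.

Lemma unitary_rep_XpXm_ket T m :
  rep_op T gXp (rep_op T gXm (rep_ket T m)) =
  rho (toC (eps * (m%:~R + rep_lam T))) *: rep_ket T m.
Proof.
have [h1 h2] := unitary_rep_rep T.
rewrite -[LHS]/(nc_eval (rep_op T) (nc_mul (nc_gen gXp) (nc_gen gXm)) _).
rewrite (h1 _ _ (eqA_XpXm eps)) /= (h2 _ _ _ (unitary_rep_X0_ket T m)).
by rewrite mul0r addr0.
Qed.

Lemma unitary_rep_XmXp_ket T m :
  rep_op T gXm (rep_op T gXp (rep_ket T m)) =
  rho (toC (eps * ((m + 1)%:~R + rep_lam T))) *: rep_ket T m.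
Proof.
have [h1 h2] := unitary_rep_rep T.
rewrite -[LHS]/(nc_eval (rep_op T) (nc_mul (nc_gen gXm) (nc_gen gXp)) _).
rewrite (h1 _ _ (eqA_XmXp eps)) /= (h2 _ _ _ (unitary_rep_X0_ket T m)).
rewrite -toCD; congr (rho (toC _) *: _).
by rewrite intrD; ring.
Qed.

Lemma unitary_rep_orthogonal_eq0 T v :
  (forall m, rep_ip T v (rep_ket T m) = 0) -> v = 0.
Proof.
move=> v0; apply: contrapT => /eqP /(@neq0_dnorm_gt0 _ _ _ (rep_ip T)).
have [_ /(_ v)[s [c [_ vE]]]] := unitary_rep_basis T.
rewrite {2}vE linear_sum /= big1 ?ltxx// => i _.
by rewrite linearZr_LR /= v0 mulr0.
Qed.

(** [X_0] is symmetric, and its real eigenvalues at distinct labels differ as [eps] is nonzero.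
    Hence [v] is orthogonal to every other ket. For [m] outside the labels this says [v = 0], which
    is how ladders stop. *)
Lemma unitary_rep_eigen T m v : eps != 0 ->
  rep_op T gX0 v = toC (eps * (m%:~R + rep_lam T)) *: v ->
  v = rep_ip T v (rep_ket T m) *: rep_ket T m.
Proof.
move=> eps0 vE; apply/eqP; rewrite -subr_eq0; apply/eqP.
apply: unitary_rep_orthogonal_eq0 => n.
rewrite linearBl linearZl_LR /=.
have [Mn|/unitary_rep_ket0 ->] := pselect (rep_labels T n); last first.
  by rewrite !linear0r subr0.
have [<-|mn] := eqVneq m n.
  have [Mm|/unitary_rep_ket0 ->] := pselect (rep_labels T m).
    by rewrite unitary_rep_orthonormal// eqxx mulr1 subrr.
  by rewrite !linear0r subr0.
have ketmn : rep_ip T (rep_ket T m) (rep_ket T n) = 0.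
  have [Mm|/unitary_rep_ket0 ->] := pselect (rep_labels T m); last by rewrite linear0l.
  by rewrite unitary_rep_orthonormal// (negbTE mn).
rewrite ketmn mulr0 subr0.
have := unitary_rep_adjoint_0 v (rep_ket T n).
rewrite vE unitary_rep_X0_ket linearZl_LR linearZr_LR /= conj_toC => /eqP.
rewrite -subr_eq0 -mulrBl mulf_eq0 => /orP[|/eqP //].
rewrite subr_eq0 => /eqP /(congr1 (@complex.Re R)) /= /(mulfI eps0) /addIr /eqP.
by rewrite eqr_int eq_sym (negbTE mn).
Qed.

(** The convention that kets vanish outside the labels makes this matrix entry of [X_-] zero just
    beyond either end, as the end conditions of [ladder_form] require. *)
Definition ladder_coef T (m : int) : Cx R :=
  rep_ip T (rep_op T gXm (rep_ket T m)) (rep_ket T (m - 1)).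

Lemma ladder_coef_out T m :
  ~ rep_labels T m \/ ~ rep_labels T (m - 1) -> ladder_coef T m = 0.
Proof.
rewrite /ladder_coef => -[] /unitary_rep_ket0 ->; last by rewrite linear0r.
by rewrite linear0 linear0l.
Qed.

Lemma ladder_coef_Xm T m : eps != 0 ->
  rep_op T gXm (rep_ket T m) = ladder_coef T m *: rep_ket T (m - 1).
Proof.
move=> eps0; apply: unitary_rep_eigen => //.
rewrite unitary_rep_X0Xm unitary_rep_X0_ket linearZ /= -scalerBl.
by congr (_ *: _); rewrite /toC -rmorphB; congr (_%:C)%C; rewrite intrB; ring.
Qed.

Lemma ladder_coef_Xp T m : eps != 0 ->
  rep_op T gXp (rep_ket T m) = Num.conj (ladder_coef T (m + 1)) *: rep_ket T (m + 1).
Proof.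
move=> eps0.
have -> : Num.conj (ladder_coef T (m + 1)) =
    rep_ip T (rep_op T gXp (rep_ket T m)) (rep_ket T (m + 1)).
  rewrite /ladder_coef addrK -unitary_rep_adjoint_p.
  by rewrite [RHS]hermC /= expr0 mul1r.
apply: unitary_rep_eigen => //.
rewrite unitary_rep_X0Xp unitary_rep_X0_ket linearZ /= -scalerDl.
by congr (_ *: _); rewrite -toCD; congr toC; rewrite intrD; ring.
Qed.

(** If [m] is a label, compute the squared norm of [X_- |m>] through [X_+ X_-]; if [m - 1] is one,
    that of [X_+ |m - 1>] through [X_- X_+]. Beyond an end of the ladder this forces a zero of
    [rho]. *)
Lemma ladder_coef_norm T m : eps != 0 -> D_dom (rep_labels T) m ->
  `|ladder_coef T m| ^+ 2 = rho (toC (eps * (m%:~R + rep_lam T))).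
Proof.
move=> eps0 Dm.
(* The ket [k] may be zero instead of a unit vector, but then the coefficient vanishes as well. *)
have norm k : k = m \/ k = m - 1 ->
    `|ladder_coef T m| ^+ 2 * rep_ip T (rep_ket T k) (rep_ket T k) =
    `|ladder_coef T m| ^+ 2.
  move=> km; have [->|D0] := eqVneq (ladder_coef T m) 0.
    by rewrite normr0 expr0n mul0r.
  rewrite unitary_rep_orthonormal ?eqxx ?mulr1//;
    by apply: contrapT => nM; move/eqP: D0; apply; apply: ladder_coef_out;
       case: km nM => ->; [left|right].
have [Mm|Mm] := Dm.
  have := unitary_rep_adjoint_m (rep_op T gXm (rep_ket T m)) (rep_ket T m).
  rewrite unitary_rep_XpXm_ket linearZl_LR /= unitary_rep_orthonormal// eqxx mulr1.
  by rewrite ladder_coef_Xm// linearZl_LR linearZr_LR /= mulrA -normCK norm//; right.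
have := unitary_rep_adjoint_p (rep_op T gXp (rep_ket T (m - 1))) (rep_ket T (m - 1)).
rewrite unitary_rep_XmXp_ket linearZl_LR /= unitary_rep_orthonormal// eqxx mulr1.
rewrite ladder_coef_Xp// subrK linearZl_LR linearZr_LR /= mulrA.
by rewrite conjCK -normCKC norm//; left.
Qed.

Lemma unitary_rep_ladder_form T : eps != 0 -> ladder_form T (ladder_coef T).
Proof.
move=> eps0; split => m.
- by move=> _; exact: ladder_coef_Xp.
- by move=> _; exact: ladder_coef_Xm.
- by move=> Dm; rewrite -mulrDr; exact: ladder_coef_norm.
- move=> Mm min; apply: ladder_coef_out; right => /min; lia.
- move=> Mm max; apply: ladder_coef_out; left => /max; lia.
Qed.

Lemma ladder_form_phase T T' (D D' : int -> Cx R) m :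
  ladder_form T D -> ladder_form T' D' ->
  rep_labels T = rep_labels T' -> rep_lam T = rep_lam T' ->
  D_dom (rep_labels T) m -> exists2 theta : Cx R, `|theta| = 1 & D' m = theta * D m.
Proof.
move=> [_ _ nD _ _] [_ _ nD' _ _] EM El Dm.
have nE : `|D' m| = `|D m|.
  apply/eqP; rewrite -(@eqrXn2 _ 2)//; apply/eqP.
  by rewrite nD// nD' -?EM// El.
have [D0|D0] := eqVneq (D m) 0.
  exists 1; first exact: normr1.
  by apply/eqP; rewrite D0 mulr0 -normr_eq0 nE D0 normr0.
exists (D' m / D m); last by rewrite divfK.
by rewrite normf_div nE divff// normr_eq0.
Qed.

Section supported_labels.
Context {T : unitary_rep rho eps}.
Hypotheses (eps0 : eps != 0) (supp : supported T).

Local Notation J := [set x | I_set rho (eps * x)].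

Lemma supported_closure m : D_dom (rep_labels T) m ->
  closure J (m%:~R + rep_lam T).
Proof. by move=> Dm; rewrite closure_preimage_scale//=; exact: supp. Qed.

(** Stopping below [m] would make the coefficient at [m] zero, although its squared modulus is a
    positive value of [rho]. *)
Lemma supported_pred m : rep_labels T m -> J (m%:~R + rep_lam T) ->
  rep_labels T (m - 1).
Proof.
move=> Mm; apply: contraPP => nM /=; rewrite /I_set /= -ladder_coef_norm//; last by left.
by rewrite ladder_coef_out ?normr0 ?expr0n ?ltxx//; right.
Qed.

Lemma supported_succ m : rep_labels T m -> J ((m + 1)%:~R + rep_lam T) ->
  rep_labels T (m + 1).
Proof.
move=> Mm; apply: contraPP => nM /=.
rewrite /I_set /= -ladder_coef_norm//; last by right; rewrite addrK.
by rewrite ladder_coef_out ?normr0 ?expr0n ?ltxx//; left.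
Qed.

End supported_labels.

End unitary_rep_theory.

(** * Finitely supported functions on a set of labels *)

Section ket_space.
Context {K : numClosedFieldType}.

Definition ket_pred (M : set int) : {pred int -> K} :=
  fun f => `[< exists s : seq int, forall m, f m != 0 -> m \in s /\ M m >].

Lemma ket_pred_submod (M : set int) : submod_closed (ket_pred M).
Proof.
split; first by apply/asboolP; exists [::] => m; rewrite /= eqxx.
move=> a f g /asboolP[s sP] /asboolP[t tP]; apply/asboolP; exists (s ++ t) => m.
rewrite mem_cat => h; have [f0|f0] := eqVneq (f m) 0; last by have [-> ?] := sP m f0.
have [|-> Mm] := tP m; last by rewrite orbT.
by apply: contraNneq h => g0; rewrite /= !fctE /= f0 g0 scaler0 addr0.
Qed.

HB.instance Definition _ (M : set int) :=
  GRing.isSubmodClosed.Build K (int -> K) (ket_pred M) (ket_pred_submod M).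

Record ket_space (M : set int) := KetSpace {
  ket_fun :> int -> K;
  ket_funP : ket_fun \in ket_pred M }.


HB.instance Definition _ (M : set int) := [isSub for @ket_fun M].
HB.instance Definition _ (M : set int) := [Choice of ket_space M by <:].
HB.instance Definition _ (M : set int) :=
  [SubChoice_isSubLmodule of ket_space M by <:].

Context {M : set int}.
Implicit Types (u v w : ket_space M) (a : K) (m k : int).

Lemma ket_space_ext u v : (forall m, u m = v m) -> u = v.
Proof. by move=> uv; apply: val_inj; apply/funext. Qed.

Lemma ket_spaceD u v m : (u + v) m = u m + v m.
Proof. by []. Qed.

Lemma ket_spaceZ a v m : (a *: v) m = a * v m.
Proof. by []. Qed.

Lemma ket_space0 m : (0 : ket_space M) m = 0.
Proof. by []. Qed.

Lemma ket_space_sum (I : Type) (s : seq I) (F : I -> ket_space M) m :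
  (\sum_(i <- s) F i) m = \sum_(i <- s) F i m.
Proof. by elim/big_rec2: _ => // i x y _ <-. Qed.

Lemma ket_space_out v m : ~ M m -> v m = 0.
Proof.
move=> nM; have /asboolP[s sP] := ket_funP v.
by apply/eqP; apply: contrapT => /negP /sP[].
Qed.

Lemma ket_space_support v : exists2 s : seq int, uniq s &
  forall m, v m != 0 -> m \in s /\ M m.
Proof.
have /asboolP[s sP] := ket_funP v; exists (undup s); first exact: undup_uniq.
by move=> m; rewrite mem_undup; exact: sP.
Qed.

(** Summing over all integers avoids choosing a list; [ket_dotE] then allows any list that contains
    the support of the product. *)
Definition ket_dot u v : K := \sum_(m \in setT) u m * Num.conj (v m).

Lemma ket_dotE (s : seq int) u v : uniq s ->
  (forall m, u m * Num.conj (v m) != 0 -> m \in s) ->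
  ket_dot u v = \sum_(m <- s) u m * Num.conj (v m).
Proof.
move=> us su; rewrite /ket_dot (fsbigE s)// => [|i _].
  by apply: eq_bigl => i; exact: mem_set.
by apply: contraNeq; exact: su.
Qed.

Lemma ket_dot_sym u v : ket_dot u v = Num.conj (ket_dot v u).
Proof.
have [s us sP] := ket_space_support u.
have nz (x y : ket_space M) m : x m * Num.conj (y m) != 0 -> x m != 0 /\ y m != 0.
  by rewrite mulf_eq0 negb_or conjC_eq0 => /andP.
rewrite !(@ket_dotE s)//; try by move=> m /nz[h1 h2]; have [] := sP m.
by rewrite rmorph_sum; apply: eq_bigr => m _; rewrite rmorphM /= conjCK mulrC.
Qed.

Lemma ket_dot_linearl w : scalar (ket_dot^~ w).
Proof.
move=> a u v.
have [s us sP] := ket_space_support u; have [t ut tP] := ket_space_support v.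
have sub m : u m != 0 \/ v m != 0 -> m \in undup (s ++ t).
  by rewrite mem_undup mem_cat => -[/sP[->]//|/tP[->]]; rewrite orbT.
rewrite !(@ket_dotE (undup (s ++ t))) ?undup_uniq//.
- rewrite mulr_sumr -big_split; apply: eq_bigr => m _.
  by rewrite ket_spaceD ket_spaceZ mulrDl mulrA.
- by move=> m; rewrite mulf_eq0 negb_or => /andP[h _]; apply: sub; right.
- by move=> m; rewrite mulf_eq0 negb_or => /andP[h _]; apply: sub; left.
- move=> m; rewrite mulf_eq0 negb_or => /andP[h _]; apply: sub.
  have [u0|] := eqVneq (u m) 0; last by left.
  by right; apply: contraNneq h => v0; rewrite ket_spaceD ket_spaceZ u0 v0 mulr0 addr0.
Qed.

Lemma ket_dot_linearr u : linear_for (Num.conj \; *%R) (ket_dot u).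
Proof.
move=> a v w; rewrite ket_dot_sym ket_dot_linearl rmorphD rmorphM /=.
by rewrite -!(ket_dot_sym u).
Qed.

Lemma ket_dot_gt0 u : u != 0 -> 0 < ket_dot u u.
Proof.
move=> u0; have [s us sP] := ket_space_support u.
have dE := @ket_dotE s u u us.
have ge0 m : 0 <= u m * Num.conj (u m) by rewrite -normCK exprn_ge0.
rewrite dE; last by move=> m; rewrite mulf_eq0 negb_or => /andP[/sP[]].
rewrite lt_neqAle sumr_ge0// andbT eq_sym; apply: contra u0.
rewrite psumr_eq0// => /allP h; apply/eqP/ket_space_ext => m.
rewrite ket_space0; apply/eqP; apply: contrapT => /negP um.
have [ms _] := sP m um; have := h m ms; rewrite /= mulf_eq0 conjC_eq0 orbb.
by rewrite (negbTE um).
Qed.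

HB.instance Definition _ := @bilinear_isBilinear.Build K (ket_space M) (ket_space M) K
  *%R (Num.conj \; *%R) ket_dot (ket_dot_linearl, ket_dot_linearr).

Lemma ket_dot_hermitian u v : ket_dot u v = (-1) ^+ false * Num.conj (ket_dot v u).
Proof. by rewrite expr0 mul1r -ket_dot_sym. Qed.

HB.instance Definition _ := @isHermitianSesquilinear.Build K (ket_space M) false
  Num.conj ket_dot ket_dot_hermitian.

HB.instance Definition _ := @isDotProduct.Build K (ket_space M) ket_dot ket_dot_gt0.

(** A weighted shift truncated to [M]. All generators act this way, the diagonal ones with [k = 0],
    so linearity and adjoints are settled once for all of them. *)
Definition ket_shift_fun (c : int -> K) k v m : K :=
  if `[< M m >] then c m * v (m + k) else 0.

Lemma ket_shift_subproof c k v : ket_shift_fun c k v \in ket_pred M.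
Proof.
have [s us sP] := ket_space_support v.
apply/asboolP; exists [seq i - k | i <- s] => m; rewrite /ket_shift_fun.
case: asboolP => [Mm|]; last by rewrite eqxx.
rewrite mulf_eq0 negb_or => /andP[_ /sP[h _]]; split => //.
by apply/mapP; exists (m + k) => //; rewrite addrK.
Qed.

Definition ket_shift c k v : ket_space M := KetSpace (ket_shift_subproof c k v).

Lemma ket_shiftE c k v m : M m -> ket_shift c k v m = c m * v (m + k).
Proof. by move=> Mm; rewrite /= /ket_shift_fun asboolT. Qed.

Lemma ket_shift_linear c k : linear (ket_shift c k).
Proof.
move=> a u v; apply: ket_space_ext => m.
have [Mm|nM] := pselect (M m); last by rewrite !ket_space_out.
by rewrite ket_spaceD ket_spaceZ !ket_shiftE// ket_spaceD ket_spaceZ; ring.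
Qed.

HB.instance Definition _ c k := @GRing.isLinear.Build K (ket_space M) (ket_space M)
  _ (ket_shift c k) (ket_shift_linear c k).

(** Reindex the sum by [m + k]. Truncation kills every term in which [m] or [m + k] leaves [M], so
    the weights need to match only when both are labels. *)
Lemma ket_shift_adjoint c d k k' v w : k + k' = 0 ->
  (forall m, M m -> M (m + k) -> Num.conj (c m) = d (m + k)) ->
  ket_dot v (ket_shift c k w) = ket_dot (ket_shift d k' v) w.
Proof.
move=> kk cd; rewrite /ket_dot [RHS](reindex_fsbigT (fun m => m + k)); last first.
  by exists (fun m => m - k) => m; rewrite ?addrK ?subrK.
apply: eq_fsbigr => m _.
have [Mm|nM] := pselect (M m); last first.
  rewrite (ket_space_out v nM) mul0r.
  have [Mk|nMk] := pselect (M (m + k)); last by rewrite ket_space_out// mul0r.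
  by rewrite ket_shiftE// -addrA kk addr0 (ket_space_out v nM) mulr0 mul0r.
rewrite ket_shiftE//; have [Mk|nMk] := pselect (M (m + k)); last first.
  by rewrite !(ket_space_out _ nMk) mulr0 rmorph0 !mulr0.
by rewrite ket_shiftE// -addrA kk addr0 rmorphM /= cd// mulrCA mulrA.
Qed.

Lemma ket_subproof m : (fun n => (`[< M m >] && (n == m))%:R) \in ket_pred M.
Proof.
apply/asboolP; exists [:: m] => n; rewrite inE.
by case: asboolP => Mm; case: (eqVneq n m) => [->|]; rewrite /= ?eqxx.
Qed.

Definition ket m : ket_space M := KetSpace (ket_subproof m).

Lemma ketE m n : M m -> ket m n = (n == m)%:R.
Proof. by move=> Mm; rewrite /= asboolT. Qed.

Lemma ket_out m : ~ M m -> ket m = 0.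
Proof. by move=> Mm; apply: ket_space_ext => n; rewrite /= asboolF. Qed.

Lemma ket_orthonormal m n : M m -> M n -> ket_dot (ket m) (ket n) = (m == n)%:R.
Proof.
move=> Mm Mn; rewrite (@ket_dotE [:: m])// => [|k].
  by rewrite big_seq1 !ketE// eqxx mul1r conjC_nat.
by rewrite ketE// inE mulf_eq0 negb_or; case: (k == m); rewrite ?eqxx.
Qed.

Lemma ket_basis : is_basis M ket.
Proof.
have sumE (s : seq int) (c : int -> K) n : uniq s -> (forall i, i \in s -> M i) ->
    (\sum_(i <- s) c i *: ket i) n = if n \in s then c n else 0.
  move=> us sM; rewrite ket_space_sum.
  rewrite (eq_big_seq (fun i => if i == n then c n else 0)) => [|i si].
    case: ifPn => ns.
      by rewrite (bigD1_seq n)//= eqxx big1 ?addr0// => j /negbTE ->.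
    by rewrite big1_seq// => j /andP[_ js]; case: eqP js ns => // -> ->.
  rewrite ket_spaceZ ketE; last exact: sM.
  by rewrite eq_sym; case: eqP => [->|]; rewrite ?mulr1 ?mulr0.
split => [s c us sM s0 i si|v].
  by have := sumE s c i us sM; rewrite s0 si.
have [s us sP] := ket_space_support v.
(* The list [s] may contain integers outside [M]; filtering by the support removes them. *)
exists [seq i <- s | v i != 0], v; split => [i|].
  by rewrite mem_filter => /andP[/sP[]].
apply: ket_space_ext => n; rewrite sumE ?filter_uniq// => [|i]; last first.
  by rewrite mem_filter => /andP[/sP[]].
rewrite mem_filter; have [->|vn] := eqVneq (v n) 0; first by [].
by have [->] := sP n vn.
Qed.

End ket_space.

(** * The ladder representation *)

Section ladder_rep.
Context {R : realType} (rho : Cx R -> Cx R) (eps l : R) (M : set int).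
Hypotheses (rho_real : forall u : R, rho (toC u) \is Num.real).

Local Notation x m := (eps * (m%:~R + l)).

Hypotheses (l01 : 0 <= l < 1) (M0 : M !=set0).
Hypothesis rho_ge0 : forall m, D_dom M m -> 0 <= rhoR rho (x m).
Hypothesis rho_first : forall m, M m -> ~ M (m - 1) -> rhoR rho (x m) = 0.
Hypothesis rho_last : forall m, M m -> ~ M (m + 1) -> rhoR rho (x (m + 1)) = 0.

(* This need not vanish at the ends of M: [ket_shift] itself truncates to M. *)
Definition ladder_amp (m : int) : R := Num.sqrt (rhoR rho (x m)).

(** Operators act on coefficient functions: raising the label means reading the value at [m - 1], so
    [gXp] is a shift by -1. All phases are taken to be 1. *)
Definition ladder_op (g : gen) : {linear ket_space (K := Cx R) M -> ket_space (K := Cx R) M} :=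
  match g with
  | gX0 => ket_shift (fun m => toC (x m)) 0
  | gXp => ket_shift (fun m => toC (ladder_amp m)) (-1)
  | gXm => ket_shift (fun m => toC (ladder_amp (m + 1))) 1
  | gRho r => ket_shift (fun m => rho (toC (x m + r%:~R * eps))) 0
  end.

Implicit Types (v w : ket_space (K := Cx R) M) (m : int).

Lemma ladder_X0E v m : M m -> ladder_op gX0 v m = toC (x m) * v m.
Proof. by move=> Mm; rewrite ket_shiftE// addr0. Qed.

Lemma ladder_RhoE r v m : M m ->
  ladder_op (gRho r) v m = rho (toC (x m + r%:~R * eps)) * v m.
Proof. by move=> Mm; rewrite ket_shiftE// addr0. Qed.

Lemma ladder_XpE v m : M m -> ladder_op gXp v m = toC (ladder_amp m) * v (m - 1).
Proof. exact: ket_shiftE. Qed.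

Lemma ladder_XmE v m : M m ->
  ladder_op gXm v m = toC (ladder_amp (m + 1)) * v (m + 1).
Proof. exact: ket_shiftE. Qed.

(** Used for right distributivity and for the centrality of constants, where [a] acts on a sum or on
    a multiple. *)
Lemma nc_eval_linear (a : ncpoly R) : linear (nc_eval ladder_op a).
Proof.
elim: a => [c|g|a IHa b IHb|a IHa b IHb] k u v /=.
- by rewrite scalerDr !scalerA mulrC.
- exact: linearP.
- by rewrite IHa IHb scalerDr addrACA.
- by rewrite IHb IHa.
Qed.

Lemma ladder_amp_sq m : D_dom M m -> toC (ladder_amp m) * toC (ladder_amp m) = rho (toC (x m)).
Proof. by move=> Dm; rewrite -toCM -expr2 sqr_sqrtr ?rho_ge0// (toC_rhoR rho_real). Qed.

(** The relations are checked one coefficient at a time. At the ends of [M] the commutation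
    relations become [0 = 0], whereas [X_+ X_-] and [X_- X_+] are truncated to 0 there and need
    [rho_first] and [rho_last]. *)
Lemma ladder_is_rep : is_rep rho eps ladder_op.
Proof.
split; last first.
  move=> r y v vE; apply: ket_space_ext => m.
  have [Mm|nM] := pselect (M m); last by rewrite !ket_space_out.
  (* Where the eigenvector [v] has a nonzero coefficient, its eigenvalue [y] must be the diagonal
     entry of [X_0]. *)
  rewrite ladder_RhoE// ket_spaceZ; have [->|v0] := eqVneq (v m) 0; first by rewrite !mulr0.
  have /(congr1 (fun f : ket_space M => f m)) := vE.
  by rewrite ladder_X0E// ket_spaceZ => /(mulIf v0) <-; rewrite toCD.
move=> a b; elim => {a b}.
- by [].
- by move=> a b _ IH v; rewrite IH.
- by move=> a b c _ IH _ IH' v; rewrite IH IH'.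
- by move=> a a' b b' _ IH _ IH' v /=; rewrite IH IH'.
- by move=> a a' b b' _ IH _ IH' v /=; rewrite IH IH'.
- by move=> a b c v /=; rewrite addrA.
- by move=> a b v /=; rewrite addrC.
- by move=> a v /=; rewrite scale0r add0r.
- by move=> a v /=; rewrite scaleN1r subrr scale0r.
- by [].
- by move=> a v /=; rewrite scale1r.
- by [].
- move=> a b c v /=; have := nc_eval_linear a 1 (nc_eval ladder_op b v) (nc_eval ladder_op c v).
  by rewrite !scale1r.
- by move=> c d v /=; rewrite scalerDl.
- by move=> c d v /=; rewrite scalerA.
- move=> c a v /=; have := nc_eval_linear a c v 0.
  have e0 : nc_eval ladder_op a 0 = 0.
    have := nc_eval_linear a (-1) 0 0.
    by rewrite scaler0 addr0 scaleN1r addNr.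
  by rewrite e0 !addr0.
- move=> r v /=; apply: ket_space_ext => m.
  have [Mm|nM] := pselect (M m); last by rewrite !ket_space_out.
  by rewrite ladder_X0E// !ladder_RhoE// ladder_X0E// mulrCA.
- move=> r s v /=; apply: ket_space_ext => m.
  have [Mm|nM] := pselect (M m); last by rewrite !ket_space_out.
  by rewrite !ladder_RhoE// mulrCA.
- move=> v /=; apply: ket_space_ext => m.
  have [Mm|nM] := pselect (M m); last by rewrite !ket_space_out.
  rewrite ket_spaceD !ket_spaceZ ladder_X0E// !ladder_XpE//.
  have [Mm1|nM1] := pselect (M (m - 1)).
    rewrite ladder_X0E//.
    have -> : toC (x m) = toC (x (m - 1)) + toC eps.
      by rewrite -toCD; congr toC; rewrite intrB; ring.
    by ring.
  by rewrite !ket_space_out// !mulr0 addr0.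
- move=> v /=; apply: ket_space_ext => m.
  have [Mm|nM] := pselect (M m); last by rewrite !ket_space_out.
  rewrite ket_spaceD !ket_spaceZ ladder_X0E// !ladder_XmE//.
  have [Mm1|nM1] := pselect (M (m + 1)).
    rewrite ladder_X0E//.
    have -> : toC (x m) = toC (x (m + 1)) - toC eps.
      by rewrite /toC -rmorphB; congr (_%:C)%C; rewrite intrD; ring.
    by ring.
  by rewrite !ket_space_out// !mulr0 addr0.
- move=> r v /=; apply: ket_space_ext => m.
  have [Mm|nM] := pselect (M m); last by rewrite !ket_space_out.
  rewrite ladder_RhoE// !ladder_XpE//.
  have [Mm1|nM1] := pselect (M (m - 1)).
    rewrite ladder_RhoE// mulrCA; congr (_ * (rho (toC _) * _)).
    by rewrite !intrD; ring.
  by rewrite !ket_space_out// !mulr0.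
- move=> r v /=; apply: ket_space_ext => m.
  have [Mm|nM] := pselect (M m); last by rewrite !ket_space_out.
  rewrite ladder_RhoE// !ladder_XmE//.
  have [Mm1|nM1] := pselect (M (m + 1)).
    rewrite ladder_RhoE// mulrCA; congr (_ * (rho (toC _) * _)).
    by rewrite !intrD; ring.
  by rewrite !ket_space_out// !mulr0.
- move=> v /=; apply: ket_space_ext => m.
  have [Mm|nM] := pselect (M m); last by rewrite !ket_space_out.
  rewrite ladder_XpE// ladder_RhoE// mul0r addr0.
  have [Mm1|nM1] := pselect (M (m - 1)).
    by rewrite ladder_XmE// subrK mulrA ladder_amp_sq//; left.
  by rewrite (ket_space_out _ nM1) (toC_rhoR rho_real) rho_first// mulr0 mul0r.
- move=> v /=; apply: ket_space_ext => m.
  have [Mm|nM] := pselect (M m); last by rewrite !ket_space_out.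
  rewrite ladder_XmE// ladder_RhoE//.
  have -> : x m + 1%:~R * eps = x (m + 1) by rewrite intrD; ring.
  have [Mm1|nM1] := pselect (M (m + 1)).
    by rewrite ladder_XpE// addrK mulrA ladder_amp_sq//; left.
  by rewrite (ket_space_out _ nM1) (toC_rhoR rho_real) rho_last// mulr0 mul0r.
Qed.

Lemma ladder_is_unitary : Defs.is_unitary ket_dot ladder_op.
Proof.
elim => [c|g|a IHa b IHb|a IHa b IHb] v w /=.
- by rewrite linearZl_LR linearZr_LR /=.
- case: g => [|||r] /=; apply: ket_shift_adjoint => // m Mm Mk.
  + by rewrite conj_toC addr0.
  + by rewrite conj_toC subrK.
  + by rewrite conj_toC.
  + by rewrite addr0 (toC_rhoR rho_real) conj_toC.
- by rewrite linearDl linearDr /= IHa IHb.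
- by rewrite IHa IHb.
Qed.

Lemma ladder_X0_ket m : M m ->
  ladder_op gX0 (ket m) = toC (x m) *: (ket m : ket_space (K := Cx R) M).
Proof.
move=> Mm; apply: ket_space_ext => n.
have [Mn|nM] := pselect (M n); last by rewrite !ket_space_out.
rewrite ladder_X0E// ket_spaceZ !ketE//.
by have [->|] := eqVneq n m; rewrite ?mulr0.
Qed.

Definition ladder_rep : unitary_rep rho eps :=
  UnitaryRep ladder_is_rep ladder_is_unitary M0 l01 ket_basis
    (@ket_orthonormal _ M) (@ket_out _ M) ladder_X0_ket.

End ladder_rep.

(** * Classification *)

Lemma one_sided_infinite_range (p : int) (M : set int) :
  M = [set m | p <= m] \/ M = [set m | m <= p] ->
  [/\ one_sided M, is_range M &
    forall n, exists s : seq int, [/\ uniq s, size s = n & forall m, m \in s -> M m]].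
Proof.
case=> ->; split.
- left; split; first by exists p.
  by move=> [b hb]; have := hb (`|p| + `|b| + 1) ; rewrite /=; lia.
- by move=> a b c /=; lia.
- move=> n; exists [seq p + i%:Z | i <- iota 0 n]; split.
  + by rewrite map_inj_uniq ?iota_uniq// => i j; lia.
  + by rewrite size_map size_iota.
  + by move=> _ /mapP[i _ ->] /=; lia.
- right; split; last by exists p.
  by move=> [b hb]; have := hb (- `|p| - `|b| - 1); rewrite /=; lia.
- by move=> a b c /=; lia.
- move=> n; exists [seq p - i%:Z | i <- iota 0 n]; split.
  + by rewrite map_inj_uniq ?iota_uniq// => i j; lia.
  + by rewrite size_map size_iota.
  + by move=> _ /mapP[i _ ->] /=; lia.
Qed.

Lemma exactly_one_length (R : realType) (J : set R) : is_interval J -> J !=set0 ->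
  exactly_one (set_length J < +oo)%E (one_sided J) (J = setT).
Proof.
move=> iJ J0; rewrite /exactly_one /one_sided (propext (set_length_lty J)).
have nT : J = setT -> ~ has_lbound J /\ ~ has_ubound J.
  move=> ->; split=> -[b hb].
    by have := hb (b - 1) Logic.I; lra.
  by have := hb (b + 1) Logic.I; lra.
have unb := interval_unbounded_setT iJ.
have [lb|lb] := pselect (has_lbound J); have [ub|ub] := pselect (has_ubound J).
- by apply: Or31; split; tauto.
- by apply: Or32; split; tauto.
- by apply: Or32; split; tauto.
- by apply: Or33; split; [tauto..|exact: unb].
Qed.

Section theorem.
Context {R : realType} {rho : Cx R -> Cx R} {eps : R}.
Hypotheses (rho_analytic : analytic rho)
  (rho_real : forall u : R, rho (toC u) \is Num.real) (eps0 : eps != 0)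
  (I_connected : connected (I_set rho)) (I_nonempty : I_set rho !=set0).

Local Notation I := (I_set rho).
Local Notation J := [set x | I_set rho (eps * x)].
Implicit Types T : unitary_rep rho eps.

Lemma I_set_interval : is_interval I.
Proof. exact/connected_intervalP. Qed.

Lemma scaled_I_open : open J.
Proof. by apply: open_preimage_scale; exact: I_set_open. Qed.

Lemma scaled_I_interval : is_interval J.
Proof. by apply: is_interval_preimage_scale; exact: I_set_interval. Qed.

Lemma scaled_I_neq0 : J !=set0.
Proof. by have [u Iu] := I_nonempty; exists (eps^-1 * u); rewrite /= mulVKf. Qed.

Lemma scaled_I_setT : J = setT <-> I = setT.
Proof.
split => [JT|->//]; apply/seteqP; split => // u _.
have : J (eps^-1 * u) by rewrite JT.
by rewrite /= mulVKf.
Qed.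

(** The absolute value arises because a negative [eps] exchanges the two endpoints. *)
Lemma I_set_length p q : boundary_pt J p -> boundary_pt J q -> p < q ->
  set_length I = (`|eps| * (q - p))%:E.
Proof.
move=> /(boundary_pt_preimage_scale _ _ eps0) bp /(boundary_pt_preimage_scale _ _ eps0) bq pq.
move: eps0; rewrite neq_lt => /orP[e0|e0].
  rewrite (set_length_segment I_set_interval I_nonempty bq bp) ?ltr_nM2l//.
  by rewrite ltr0_norm//; congr _%:E; ring.
rewrite (set_length_segment I_set_interval I_nonempty bp bq) ?ltr_pM2l//.
by rewrite gtr0_norm//; congr _%:E; ring.
Qed.

Lemma scaled_I_endpoints : (set_length I < +oo)%E ->
  exists p q, [/\ boundary_pt J p, boundary_pt J q & p < q].
Proof.
move=> /set_length_lty[lb ub]; have oI := I_set_open rho_real rho_analytic.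
have b1 : boundary_pt J (eps^-1 * inf I).
  by apply/boundary_pt_preimage_scale => //; rewrite mulVKf//; exact: boundary_pt_inf.
have b2 : boundary_pt J (eps^-1 * sup I).
  by apply/boundary_pt_preimage_scale => //; rewrite mulVKf//; exact: boundary_pt_sup.
(* If the two coincided, [I] would reduce to the point [sup I], which an open set cannot contain. *)
have neq : eps^-1 * inf I != eps^-1 * sup I.
  apply/eqP => /(mulfI (invr_neq0 eps0)) E; have [u Iu] := I_nonempty.
  apply: (boundary_pt_sup oI I_nonempty ub).2.
  have -> : sup I = u; last by [].
  apply/eqP; rewrite eq_le -{1}E (inf_lbound lb Iu) /=.
  exact: ub_le_sup.
move: neq; rewrite neq_lt => /orP[h|h].
  by exists (eps^-1 * inf I), (eps^-1 * sup I).
by exists (eps^-1 * sup I), (eps^-1 * inf I).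
Qed.

Lemma ladder_exists (l : R) : 0 <= l < 1 ->
  (forall e, boundary_pt J e -> exists k : int, e = k%:~R + l) ->
  exists2 T : unitary_rep rho eps, supported T & rep_lam T = l.
Proof.
move=> l01 lattice; pose M := closure_labels J l.
have clI (m : int) : closure J (m%:~R + l) -> closure I (eps * (m%:~R + l)).
  by rewrite closure_preimage_scale.
have M_closure m : D_dom M m -> closure J (m%:~R + l).
  by case=> -[]// _; rewrite subrK.
have M0 : M !=set0 := closure_labels_neq0 scaled_I_open scaled_I_interval scaled_I_neq0 lattice.
have ge0 m : D_dom M m -> 0 <= rhoR rho (eps * (m%:~R + l)).
  move=> /M_closure/clI c; have [Iu|nI] := pselect (I (eps * (m%:~R + l))).
    by move: Iu; rewrite I_setE// => /ltW.
  by rewrite rhoR_boundary.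
have first_zero m : M m -> ~ M (m - 1) -> rhoR rho (eps * (m%:~R + l)) = 0.
  move=> Mm nM; apply: rhoR_boundary => //; first by apply: clI; exact: Mm.1.
  exact: (closure_labels_pred scaled_I_open scaled_I_interval lattice Mm nM).
have last_zero m : M m -> ~ M (m + 1) -> rhoR rho (eps * ((m + 1)%:~R + l)) = 0.
  move=> Mm nM; apply: rhoR_boundary => //; first by apply: clI; exact: Mm.2.
  exact: (closure_labels_succ scaled_I_open scaled_I_interval lattice Mm nM).
exists (ladder_rep rho_real l01 M0 ge0 first_zero last_zero) => // m Dm.
by apply: clI; exact: M_closure.
Qed.

(** Take for [lambda] the fractional part of one endpoint. A second endpoint makes the length
    finite, and the quantization hypothesis places it at an integer distance from the first. *)
Lemma supported_exists :
  ((set_length I < +oo)%E -> exists n : nat, fine (set_length I) / `|eps| = n%:R) ->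
  exists T : unitary_rep rho eps, supported T.
Proof.
move=> quant; have [IT|InT] := pselect (I = setT).
  have [|e [_ nJ]|T sT _] := @ladder_exists 0; [by lra| |by exists T].
  by exfalso; apply: nJ; rewrite /= IT.
have JnT : J <> setT by move=> /scaled_I_setT.
have [e be] := boundary_pt_exists scaled_I_open scaled_I_interval scaled_I_neq0 JnT.
have [|e' be'|T sT _] := @ladder_exists (e - (Num.floor e)%:~R); last by exists T.
  have := floor_le e; have := floorD1_gt e; rewrite intrD; lra.
have len p q : boundary_pt J p -> boundary_pt J q -> p < q ->
    exists n : nat, q - p = n%:R.
  move=> bp bq pq; have lE := I_set_length bp bq pq; have [|n] := quant.
    by rewrite lE ltry.
  by rewrite lE /= mulrAC mulfV ?normr_eq0// mul1r => nE; exists n.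
have [lt|lt|<-] := ltgtP e e'; last first.
- by exists (Num.floor e); rewrite addrC subrK.
- have [n nE] := len _ _ be' be lt; exists (Num.floor e - n%:Z).
  by rewrite intrB -pmulrn -nE; ring.
- have [n nE] := len _ _ be be' lt; exists (Num.floor e + n%:Z).
  by rewrite intrD -pmulrn -nE; ring.
Qed.

Lemma supported_labelsE T : supported T -> rep_labels T =
  [set m | closure J (m%:~R + rep_lam T) /\ closure J ((m + 1)%:~R + rep_lam T)].
Proof.
move=> sT; apply: ladder_labelsE; first exact: scaled_I_interval.
- by move=> m; exact: supported_closure.
- by move=> m; exact: supported_pred.
- by move=> m; exact: supported_succ.
- exact: unitary_rep_labels_neq0.
Qed.

Lemma supported_lattice T e : supported T -> boundary_pt J e ->
  exists k : int, e = k%:~R + rep_lam T.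
Proof.
move=> sT; apply: ladder_boundary_pt; first exact: scaled_I_interval.
- by move=> m; exact: supported_closure.
- by move=> m; exact: supported_pred.
- by move=> m; exact: supported_succ.
- exact: unitary_rep_labels_neq0.
Qed.

Lemma supported_labels_setT T : supported T -> I = setT -> rep_labels T = setT.
Proof.
move=> sT IT; rewrite supported_labelsE//; apply/seteqP; split => // m _.
by split; apply: subset_closure; rewrite /= IT.
Qed.

(** Any endpoint lies on both lattices and so determines [lambda]; then [J] and [lambda] determine
    the labels. Without endpoints the labels are all integers, whatever [lambda] is. *)
Lemma supported_unique T T' : supported T -> supported T' ->
  rep_labels T = rep_labels T' /\ (I <> setT -> rep_lam T = rep_lam T').
Proof.
move=> sT sT'.
have lE : I <> setT -> rep_lam T = rep_lam T'.
  move=> InT; have JnT : J <> setT by move=> /scaled_I_setT.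
  have [e be] := boundary_pt_exists scaled_I_open scaled_I_interval scaled_I_neq0 JnT.
  have [k kE] := supported_lattice sT be; have [k' k'E] := supported_lattice sT' be.
  by apply: (@int_add_frac_inj _ k k'); rewrite ?unitary_rep_lam// -kE.
split => //; have [IT|InT] := pselect (I = setT).
  by rewrite !supported_labels_setT.
by rewrite !supported_labelsE// lE.
Qed.

Lemma supported_finite T : supported T -> (set_length I < +oo)%E ->
  [/\ finite_set (rep_labels T), is_range (rep_labels T)
    & exists2 n : nat, has_dim (rep_space T) n & fine (set_length I) / `|eps| = n%:R].
Proof.
move=> sT /scaled_I_endpoints[p [q [bp bq pq]]].
have [k kE] := supported_lattice sT bp; have [k' k'E] := supported_lattice sT bq.
have kk' : k < k' by move: pq; rewrite kE k'E ltrD2r ltr_int.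
(* The range is half-open because [m + 1] must also stay in the closure: the upper endpoint is no
   label, so the dimension is [q - p] and not one more. *)
have ME : rep_labels T = [set m | k <= m < k'].
  rewrite supported_labelsE// (closure_segmentE scaled_I_interval bp bq pq) kE k'E.
  by apply/seteqP; split => m /=; rewrite !lerD2r !ler_int; lia.
pose n := `|k' - k|%N.
have bij1 (i : nat) : `I_n i -> rep_labels T (k + i%:Z) by rewrite ME /= /n; lia.
have bij2 (i : nat) : `I_n i -> absz (k + i%:Z - k)%R = i by lia.
have bij3 (m : int) : rep_labels T m -> `I_n `|m - k|%N by rewrite ME /= /n; lia.
have bij4 (m : int) : rep_labels T m -> k + `|m - k|%N%:Z = m by rewrite ME /=; lia.
split.
- have -> : rep_labels T = (fun i : nat => k + i%:Z) @` `I_n.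
    apply/seteqP; split => [m Mm|_ [i /bij1 Mi <-] //].
    by exists `|m - k|%N; [exact: bij3|exact: bij4].
  by apply: finite_image; exact: finite_II.
- by rewrite ME => a b c /=; lia.
- exists n.
    by exists (rep_ket T \o (fun i : nat => k + i%:Z));
       exact: (is_basis_reindex bij1 bij2 bij3 bij4 (unitary_rep_basis T)).
  rewrite (I_set_length bp bq pq) /= mulrAC mulfV ?normr_eq0// mul1r kE k'E.
  have -> : k'%:~R + rep_lam T - (k%:~R + rep_lam T) = (k' - k)%:~R by rewrite intrB; ring.
  by rewrite pmulrn /n; congr (_%:~R); lia.
Qed.

Lemma supported_one_sided T : supported T -> one_sided I ->
  [/\ one_sided (rep_labels T), is_range (rep_labels T) & infinite_dim (rep_space T)].
Proof.
move=> sT /(one_sided_preimage_scale eps0) osJ.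
have [k] : exists k : int,
    rep_labels T = [set m | k <= m] \/ rep_labels T = [set m | m <= k].
  rewrite supported_labelsE//; case: osJ => -[lb ub].
    have bJ := boundary_pt_inf scaled_I_open scaled_I_neq0 lb.
    have [k kE] := supported_lattice sT bJ; exists k; left.
    rewrite (closure_right_rayE scaled_I_interval bJ ub) kE.
    by apply/seteqP; split => m /=; rewrite !lerD2r !ler_int; lia.
  have bJ := boundary_pt_sup scaled_I_open scaled_I_neq0 ub.
  (* The largest label is [k - 1], as its successor must still lie in the closure. *)
  have [k kE] := supported_lattice sT bJ; exists (k - 1); right.
  rewrite (closure_left_rayE scaled_I_interval bJ lb) kE.
  by apply/seteqP; split => m /=; rewrite !lerD2r !ler_int; lia.
move=> /one_sided_infinite_range[h1 h2 h3]; split => //.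
exact: (infinite_dim_basis (unitary_rep_basis T)).
Qed.

Lemma supported_setT T : supported T -> I = setT ->
  rep_labels T = setT /\ infinite_dim (rep_space T).
Proof.
move=> sT IT; have MT := supported_labels_setT sT IT; split => //.
apply: (infinite_dim_basis (unitary_rep_basis T)) => n; rewrite MT.
have [_ _ /(_ n)[s [us ss _]]] := one_sided_infinite_range (or_introl (erefl [set m | 0 <= m])).
by exists s.
Qed.

End theorem.

Theorem theorem4 (R : realType) (rho : Cx R -> Cx R) (eps : R)
    (rho_analytic : analytic rho)
    (rho_real : forall u : R, rho (toC u) \is Num.real)
    (eps_neq0 : eps != 0)
    (I_connected : connected (I_set rho))
    (I_nonempty : I_set rho !=set0) :
  let I := I_set rho in
  (* existence, lambda being free when I is the whole line *)
  (((set_length I < +oo)%E ->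
      exists n : nat, fine (set_length I) / `|eps| = n%:R) ->
   exists T : unitary_rep rho eps, supported T) /\
  (I = setT -> forall l : R, 0 <= l < 1 ->
   exists2 T : unitary_rep rho eps, supported T & rep_lam T = l) /\
  (* form of the representation *)
  (forall T : unitary_rep rho eps, exists D : int -> Cx R, ladder_form T D) /\
  (* uniqueness up to phase *)
  (forall (T T' : unitary_rep rho eps) (D D' : int -> Cx R),
     ladder_form T D -> ladder_form T' D' ->
     rep_labels T = rep_labels T' -> rep_lam T = rep_lam T' ->
     forall m : int, D_dom (rep_labels T) m ->
     exists2 theta : Cx R, `|theta| = 1 & D' m = theta * D m) /\
  (forall T T' : unitary_rep rho eps, supported T -> supported T' ->
     rep_labels T = rep_labels T' /\ (I <> setT -> rep_lam T = rep_lam T')) /\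
  (* the three cases *)
  exactly_one (set_length I < +oo)%E (one_sided I) (I = setT) /\
  (forall T : unitary_rep rho eps, supported T ->
     [/\ (set_length I < +oo)%E ->
           [/\ finite_set (rep_labels T), is_range (rep_labels T)
             & exists2 n : nat, has_dim (rep_space T) n
                 & fine (set_length I) / `|eps| = n%:R],
         one_sided I ->
           [/\ one_sided (rep_labels T), is_range (rep_labels T)
             & infinite_dim (rep_space T)]
       & I = setT ->
           rep_labels T = setT /\ infinite_dim (rep_space T)]).
Proof.
move=> I; rewrite /I.
split; first exact: supported_exists.
split.
  move=> IT l l01; apply: ladder_exists => // e [_ nJ].
  by exfalso; apply: nJ; rewrite /= IT.
split; first by move=> T; exists (ladder_coef T); exact: unitary_rep_ladder_form.
split; first by move=> T T' D D' hD hD' EM El m; exact: (ladder_form_phase hD hD').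
split; first exact: supported_unique.
split; first by apply: exactly_one_length => //; exact: I_set_interval.
move=> T sT; split.
- exact: supported_finite.
- exact: supported_one_sided.
- exact: supported_setT.
Qed.
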